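(* Let $\underline{C}$ be a $G$-coalgebra. The categories $\mathcal{M}^{\underline{C}\rtimes kG}$ and $\mathcal{M}^{G,\underline{C}}$ are isomorphic.
   Context: $k$ is a field, $\otimes=\otimes_k$, $G$ is a group with identity $e$; the identity map of an object $X$ is denoted $X$. A $G$-coalgebra (group coalgebra) $\underline{C}=(C_\alpha)_{\alpha\in G}$ is a family of $k$-vector spaces with $k$-linear maps $\Delta_{\alpha,\beta}:C_{\alpha\beta}\to C_\alpha\otimes C_\beta$ ($\alpha,\beta\in G$) and $\varepsilon:C_e\to k$ such that $(\Delta_{\alpha,\beta}\otimes C_\gamma)\circ\Delta_{\alpha\beta,\gamma}=(C_\alpha\otimes\Delta_{\beta,\gamma})\circ\Delta_{\alpha,\beta\gamma}$ and $(C_\alpha\otimes\varepsilon)\circ\Delta_{\alpha,e}=C_\alpha=(\varepsilon\otimes C_\alpha)\circ\Delta_{e,\alpha}$. Sweedler notation: $\Delta_{\alpha,\beta}(c)=c_{(1,\alpha)}\otimes c_{(2,\beta)}$ (summation understood). For a $G$-coalgebra $\underline{D}$, a right $\underline{D}$-comodule is a $k$-vector space $M$ with $k$-linear maps $\rho_\alpha:M\to M\otimes D_\alpha$ ($\alpha\in G$) such that $(M\otimes\varepsilon)\circ\rho_e=M$ and $(M\otimes\Delta_{\alpha,\beta})\circ\rho_{\alpha\beta}=(\rho_\alpha\otimes D_\beta)\circ\rho_\beta$ for all $\alpha,\beta\in G$. Morphisms are $k$-linear maps $f:M\to N$ with $(f\otimes D_\alpha)\circ\rho^M_\alpha=\rho^N_\alpha\circ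 f$ for all $\alpha$. This category is $\mathcal{M}^{\underline{D}}$. A right $G$-$\underline{C}$-comodule is a family $\underline{M}=(M_\alpha)_{\alpha\in G}$ of $k$-vector spaces with $k$-linear maps $\rho_{\alpha,\beta}:M_{\alpha\beta}\to M_\alpha\otimes C_\beta$ such that $(M_\alpha\otimes\varepsilon)\circ\rho_{\alpha,e}=M_\alpha$ and $(\rho_{\alpha,\beta}\otimes C_\gamma)\circ\rho_{\alpha\beta,\gamma}=(M_\alpha\otimes\Delta_{\beta,\gamma})\circ\rho_{\alpha,\beta\gamma}$. Morphisms $\underline{M}\to\underline{N}$ are families of $k$-linear maps $\varphi_\alpha:M_\alpha\to N_\alpha$ with $(\varphi_\alpha\otimes C_\beta)\circ\rho^{\underline{M}}_{\alpha,\beta}=\rho^{\underline{N}}_{\alpha,\beta}\circ\varphi_{\alpha\beta}$. This category is $\mathcal{M}^{G,\underline{C}}$. The smash coproduct $G$-coalgebra $\underline{C}\rtimes kG$ has components $(\underline{C}\rtimes kG)_\alpha=C_\alpha\rtimes kG=C_\alpha\otimes kG$, with $\Delta_{\alpha,\beta}(c\rtimes\sigma)=(c_{(1,\alpha)}\rtimes\beta\sigma)\otimes(c_{(2,\beta)}\rtimes\sigma)$ for $c\in C_{\alpha\beta}$, $\sigma\in G$, and $\varepsilon(c\rtimes\sigma)=\varepsilon(c)$ for $c\in C_e$, $\sigma\in G$. *)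

(* Defs.v *)
From HB Require Import structures.
From mathcomp Require Import all_boot all_order all_algebra.
From mathcomp Require Import boolp finmap.
From mathcomp.multinomials Require Import monalg.

Set Implicit Arguments.
Unset Strict Implicit.
Unset Printing Implicit Defensive.

Import GRing.Theory.
Local Open Scope ring_scope.

HB.lock Definition malg_ext (k : fieldType) (K : choiceType) (V : lmodType k)
    (f : K -> V) (g : {malg k[K]}) : V :=
  \sum_(x <- msupp g) g@_x *: f x.
Arguments malg_ext {k K V} f g.

Section FreeModule.
Context {k : fieldType} {K : choiceType} {V : lmodType k}.

Lemma malg_extE (f : K -> V) (g : {malg k[K]}) (d : {fset K}) :
  fsubset (msupp g) d -> malg_ext f g = \sum_(x <- d) g@_x *: f x.
Proof.
move=> gd; rewrite malg_ext.unlock (big_fset_incl _ gd) // => x _ xg.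
by rewrite mcoeff_outdom // scale0r.
Qed.

Lemma malg_ext_linear (f : K -> V) : linear (malg_ext f).
Proof.
move=> a g h; pose d := (msupp g `|` msupp h)%fset.
have gd : fsubset (msupp g) d by apply: fsubsetUl.
have hd : fsubset (msupp h) d by apply: fsubsetUr.
have ghd : fsubset (msupp (a *: g + h)) d.
  apply: fsubset_trans (msuppD_le _ _) _; apply: fsetSU; exact: msuppZ_le.
rewrite (malg_extE _ gd) (malg_extE _ hd) (malg_extE _ ghd) scaler_sumr.
rewrite -big_split; apply: eq_bigr => x _ /=.
by rewrite mcoeffD mcoeffZ scalerDl scalerA.
Qed.

HB.instance Definition _ (f : K -> V) :=
  GRing.isLinear.Build k {malg k[K]} V _ (malg_ext f) (malg_ext_linear f).

Lemma malg_extU (f : K -> V) x : malg_ext f << x >> = f x.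
Proof.
by rewrite (malg_extE f msuppU_le) big_seq_fset1 mcoeffUU scale1r.
Qed.

Lemma malgUZ a x : << a *g x >> = a *: << x >> :> {malg k[K]}.
Proof. by apply/malgP=> y; rewrite mcoeffZ !mcoeffU mulrnAr mulr1. Qed.

Lemma malg_eq (f g : {linear {malg k[K]} -> V}) :
  (forall x, f << x >> = g << x >>) -> f =1 g.
Proof.
move=> fg u; rewrite [u]monalgE !linear_sum; apply: eq_bigr => x _ /=.
by rewrite malgUZ !linearZ fg.
Qed.
End FreeModule.

Section TensorProduct.
Context {k : fieldType}.
Implicit Types M N V : lmodType k.

(* The subspace of k[M * N] spanned by the bilinearity relations. *)
Inductive tens_rel M N : {malg k[(M * N)%type]} -> Prop :=
| Tens_rel0 : tens_rel 0
| Tens_relP a u v : tens_rel u -> tens_rel v -> tens_rel (a *: u + v)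
| Tens_rell a m m' n :
    tens_rel (<< (a *: m + m', n) >> - a *: << (m, n) >> - << (m', n) >>)
| Tens_relr a m n n' :
    tens_rel (<< (m, a *: n + n') >> - a *: << (m, n) >> - << (m, n') >>).

Definition tens_ker M N : {pred {malg k[(M * N)%type]}} :=
  fun u => `[< @tens_rel M N u >].

Lemma tens_kerZ M N a (u : {malg k[(M * N)%type]}) :
  tens_ker u -> tens_ker (a *: u).
Proof.
move=> /asboolP u0; apply/asboolP; rewrite -[_ *: _]addr0.
by apply: Tens_relP => //; apply: Tens_rel0.
Qed.

Lemma tens_ker_zmod M N : zmod_closed (@tens_ker M N).
Proof.
split=> [|u v]; first by apply/asboolP; apply: Tens_rel0.
rewrite !unfold_in => /asboolP u0 /asboolP v0; apply/asboolP.
by rewrite addrC -scaleN1r; apply: Tens_relP.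
Qed.

HB.instance Definition _ M N :=
  GRing.isZmodClosed.Build {malg k[(M * N)%type]} (@tens_ker M N) (@tens_ker_zmod M N).

Definition tens_type M N : Type :=
  Quotient.quot (@tens_ker M N : zmodClosed {malg k[(M * N)%type]}).

HB.instance Definition _ M N := GRing.Zmodule.copy (tens_type M N)
  (Quotient.quot (@tens_ker M N : zmodClosed {malg k[(M * N)%type]})).

Definition tens_pi M N (u : {malg k[(M * N)%type]}) : tens_type M N :=
  (\pi_(tens_type M N) u)%qT.

Lemma tens_piP M N (u v : {malg k[(M * N)%type]}) :
  tens_pi u = tens_pi v <-> tens_rel (u - v).
Proof.
rewrite /tens_pi; split.
  by move/eqP; rewrite -Quotient.idealrBE => /asboolP.
by move=> uv; apply/eqP; rewrite -Quotient.idealrBE; apply/asboolP.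
Qed.

Lemma tens_piD M N : {morph @tens_pi M N : u v / u + v}.
Proof. exact: Quotient.pi_add. Qed.

Lemma tens_piK M N : cancel (fun x : tens_type M N => repr x) (@tens_pi M N).
Proof. by move=> x; rewrite /tens_pi reprK. Qed.

Definition tens_scale M N (a : k) (x : tens_type M N) : tens_type M N :=
  tens_pi (a *: repr x).

Lemma tens_piZ M N a (u : {malg k[(M * N)%type]}) :
  tens_pi (a *: u) = tens_scale a (tens_pi u).
Proof.
apply/tens_piP; rewrite -scalerBr; apply/asboolP/tens_kerZ/asboolP/tens_piP.
by rewrite tens_piK.
Qed.

Fact tens_scaleA M N a b (x : tens_type M N) :
  tens_scale a (tens_scale b x) = tens_scale (a * b) x.
Proof. by rewrite -[x]tens_piK -!tens_piZ scalerA. Qed.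

Fact tens_scale1 M N : left_id 1 (@tens_scale M N).
Proof. by move=> x; rewrite -[x in LHS]tens_piK -tens_piZ scale1r tens_piK. Qed.

Fact tens_scaleDr M N : right_distributive (@tens_scale M N) +%R.
Proof.
move=> a x y; rewrite -[x]tens_piK -[y]tens_piK -tens_piD -!tens_piZ.
by rewrite scalerDr tens_piD.
Qed.

Fact tens_scaleDl M N (x : tens_type M N) : {morph (@tens_scale M N)^~ x : a b / a + b}.
Proof. by move=> a b; rewrite -[x]tens_piK -!tens_piZ scalerDl tens_piD. Qed.

HB.instance Definition _ M N := GRing.Zmodule_isLmodule.Build k (tens_type M N)
  (@tens_scaleA M N) (@tens_scale1 M N) (@tens_scaleDr M N) (@tens_scaleDl M N).

Fact tens_pi_linear M N : linear (@tens_pi M N).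
Proof. by move=> a u v; rewrite tens_piD tens_piZ. Qed.

HB.instance Definition _ M N :=
  GRing.isLinear.Build k _ (tens_type M N) _ (@tens_pi M N) (@tens_pi_linear M N).

Definition tens M N : lmodType k := tens_type M N.
End TensorProduct.

HB.lock Definition pure (k : fieldType) (M N : lmodType k) (m : M) (n : N) :
  tens M N := tens_pi << (m, n) >>.
Arguments pure {k M N} m n.

HB.lock Definition tens_lift (k : fieldType) (M N V : lmodType k)
    (f : {bilinear M -> N -> V}) (x : tens M N) : V :=
  malg_ext (fun mn => f mn.1 mn.2) (repr (x : tens_type M N)).
Arguments tens_lift {k M N V} f x.

Section TensorProductTheory.
Context {k : fieldType}.
Implicit Types M N V : lmodType k.

Fact pure_bilinear M N : bilinear_for *:%R *:%R (@pure k M N).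
Proof.
split=> [n a m m'|m a n n'] /=; rewrite pure.unlock -tens_pi_linear; apply/tens_piP.
  by rewrite opprD addrA; exact: Tens_rell.
by rewrite opprD addrA; exact: Tens_relr.
Qed.

HB.instance Definition _ M N :=
  bilinear_isBilinear.Build k M N (tens M N) *:%R *:%R (@pure k M N)
    (@pure_bilinear M N).

Lemma tens_eq M N V (f g : {linear tens M N -> V}) :
  (forall m n, f (pure m n) = g (pure m n)) -> f =1 g.
Proof.
move=> fg x; rewrite -[x]tens_piK.
pose h (f' : {linear tens M N -> V}) : {linear {malg k[(M * N)%type]} -> V} :=
  f' \o @tens_pi k M N.
apply: (malg_eq (f := h f) (g := h g)) => -[m n] /=.
by have := fg m n; rewrite pure.unlock.
Qed.

Section Lift.
Variables (M N V : lmodType k) (f : {bilinear M -> N -> V}).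

Lemma tens_lift_pi u : tens_lift f (tens_pi u) = malg_ext (fun mn => f mn.1 mn.2) u.
Proof.
rewrite tens_lift.unlock; set F := malg_ext _; apply/eqP; rewrite -subr_eq0 -linearB.
have: tens_rel (repr (tens_pi u) - u) by apply/tens_piP; rewrite tens_piK.
elim=> [|a v w _ /eqP v0 _ /eqP w0|a m m' n|a m n n'].
- by rewrite linear0.
- by rewrite linearP /= v0 w0 scaler0 addr0.
- by rewrite !linearB linearZ /= !malg_extU /= linearPl /= -addrA -opprD subrr.
- by rewrite !linearB linearZ /= !malg_extU /= linearPr /= -addrA -opprD subrr.
Qed.

Fact tens_lift_linear : linear (tens_lift f).
Proof.
move=> a x y; rewrite -[x]tens_piK -[y]tens_piK -tens_pi_linear.
by rewrite !tens_lift_pi linearP.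
Qed.

HB.instance Definition _ :=
  GRing.isLinear.Build k (tens M N) V _ (tens_lift f) tens_lift_linear.

Lemma tens_liftE m n : tens_lift f (pure m n) = f m n.
Proof. by rewrite pure.unlock tens_lift_pi malg_extU. Qed.
End Lift.

Lemma tens_ind M N (P : tens M N -> Prop) :
  P 0 -> (forall a x y, P x -> P y -> P (a *: x + y)) ->
  (forall m n, P (pure m n)) -> forall x, P x.
Proof.
move=> P0 PP Pm x; rewrite -[x]tens_piK [X in tens_pi X]monalgE linear_sum /=.
apply: (big_ind P) => // [y z Py Pz|[m n] _].
  by rewrite -[y]scale1r; apply: PP.
rewrite malgUZ linearZ -[X in P X]addr0; apply: PP; last exact: P0.
by have := Pm m n; rewrite pure.unlock.
Qed.

Section Map.
Variables (M M' N N' : lmodType k).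
Variables (f : {linear M -> M'}) (g : {linear N -> N'}).

Definition pure_map (m : M) (n : N) : tens M' N' := pure (f m) (g n).

Fact pure_map_bilinear : bilinear_for *:%R *:%R pure_map.
Proof.
by split=> [n a m m'|m a n n']; rewrite /pure_map linearP ?linearPl ?linearPr.
Qed.

HB.instance Definition _ :=
  bilinear_isBilinear.Build k M N (tens M' N') *:%R *:%R pure_map
    pure_map_bilinear.

Definition tmap : {linear tens M N -> tens M' N'} := tens_lift pure_map.

Arguments tmap : simpl never.

Lemma tmapE m n : tmap (pure m n) = pure (f m) (g n).
Proof. exact: tens_liftE. Qed.
End Map.

Section Associativity.
Variables (A B C : lmodType k).

Definition pureA (c : C) (a : A) (b : B) : tens A (tens B C) :=
  pure a (pure b c).

Fact pureA_bilinear c : bilinear_for *:%R *:%R (pureA c).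
Proof.
split=> [b d a a'|a d b b']; rewrite /pureA; first by rewrite linearPl.
by rewrite linearPl linearPr.
Qed.

HB.instance Definition _ c :=
  bilinear_isBilinear.Build k A B (tens A (tens B C)) *:%R *:%R (pureA c)
    (pureA_bilinear c).

Definition pureA_lift (t : tens A B) (c : C) : tens A (tens B C) :=
  tens_lift (pureA c) t.

Fact pureA_lift_bilinear : bilinear_for *:%R *:%R pureA_lift.
Proof.
split=> [c d t t'|t d c c'] /=; first by rewrite /pureA_lift linearP.
elim/tens_ind: t => [|e x y IHx IHy|a b]; rewrite /pureA_lift.
- by rewrite !linear0 addr0.
- rewrite /pureA_lift in IHx IHy; rewrite !linearP /= IHx IHy.
  by rewrite !scalerDr !scalerA addrACA.
- by rewrite !tens_liftE /= /pureA !linearPr.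
Qed.

HB.instance Definition _ :=
  bilinear_isBilinear.Build k (tens A B) C (tens A (tens B C)) *:%R *:%R
    pureA_lift pureA_lift_bilinear.

Definition tassoc : {linear tens (tens A B) C -> tens A (tens B C)} :=
  tens_lift pureA_lift.
Arguments tassoc : simpl never.

Lemma tassocE a b c : tassoc (pure (pure a b) c) = pure a (pure b c).
Proof. by rewrite /tassoc /= tens_liftE /= /pureA_lift tens_liftE. Qed.
End Associativity.

Section Unit.
Variable M : lmodType k.

Definition scaler_op (m : M) (a : k^o) : M := (a : k) *: m.
Definition scalel_op (a : k^o) (m : M) : M := (a : k) *: m.

Fact scaler_op_bilinear : bilinear_for *:%R *:%R scaler_op.
Proof.
split=> [a b m m'|m b a a'] /=; rewrite /scaler_op.
  by rewrite scalerDr !scalerA mulrC.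
by rewrite scalerDl scalerA.
Qed.

Fact scalel_op_bilinear : bilinear_for *:%R *:%R scalel_op.
Proof. by split=> [m b a a'|a b m m']; apply scaler_op_bilinear. Qed.

HB.instance Definition _ :=
  bilinear_isBilinear.Build k M k^o M *:%R *:%R scaler_op scaler_op_bilinear.
HB.instance Definition _ :=
  bilinear_isBilinear.Build k k^o M M *:%R *:%R scalel_op scalel_op_bilinear.

Definition tunitr : {linear tens M k^o -> M} := tens_lift scaler_op.
Definition tunitl : {linear tens k^o M -> M} := tens_lift scalel_op.
Arguments tunitr : simpl never.
Arguments tunitl : simpl never.

Lemma tunitrE m (a : k^o) : tunitr (pure m a) = (a : k) *: m.
Proof. exact: tens_liftE. Qed.

Lemma tunitlE m (a : k^o) : tunitl (pure a m) = (a : k) *: m.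
Proof. exact: tens_liftE. Qed.
End Unit.

Lemma linear_eq M V (f g : {linear M -> V}) : f =1 g -> f = g.
Proof.
case: f g => [f [[fN] [fZ]]] [g [[gN] [gZ]]] /= fg.
have {}fg : f = g by apply/funext.
subst g; rewrite (Prop_irrelevance gN fN).
by have -> : gZ = fZ by apply/Prop_irrelevance.
Qed.

Lemma tmap_id M N (x : tens M N) : tmap idfun idfun x = x.
Proof.
elim/tens_ind: x => [|a x y hx hy|m n]; first by rewrite linear0.
  by rewrite linearP hx hy.
by rewrite tmapE.
Qed.

End TensorProductTheory.

Arguments tmap {k M M' N N'} f g : simpl never.
Arguments tassoc {k A B C} : simpl never.
Arguments tunitr {k M} : simpl never.
Arguments tunitl {k M} : simpl never.

(* The unwritten identifications of the informal axioms are explicit: [tassoc]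
   is (A (x) B) (x) C -> A (x) (B (x) C), [tunitr] and [tunitl] are the unit
   isomorphisms, and [ecast] transports along an equality of indices such as
   a * b * c = a * (b * c). *)
Record gcoalgebra (G : groupType) (k : fieldType) := GCoalgebra {
  gc_space :> G -> lmodType k;
  gc_comul : forall a b : G,
    {linear gc_space (a * b)%g -> tens (gc_space a) (gc_space b)};
  gc_counit : {linear gc_space 1%g -> k^o};
  gc_coassoc : forall (a b c : G) (x : gc_space (a * b * c)%g),
    tassoc (tmap (gc_comul a b) idfun (gc_comul (a * b)%g c x)) =
    tmap idfun (gc_comul b c)
      (gc_comul a (b * c)%g (ecast i (gc_space i) (esym (mulgA a b c)) x));
  gc_counitr : forall (a : G) (x : gc_space (a * 1)%g),
    tunitr (tmap idfun gc_counit (gc_comul a 1%g x)) =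
    ecast i (gc_space i) (mulg1 a) x;
  gc_counitl : forall (a : G) (x : gc_space (1 * a)%g),
    tunitl (tmap gc_counit idfun (gc_comul 1%g a x)) =
    ecast i (gc_space i) (mul1g a) x
}.

Section SmashCoproduct.
Variables (G : groupType) (k : fieldType) (C : gcoalgebra G k).

Definition smash_space (a : G) : lmodType k := tens (C a) {malg k[G]}.
Arguments smash_space : simpl never.

Section Comul.
Variables a b : G.

(* c (x) d |-> (c (x) b s) (x) (d (x) s), so that [smash_comul] below sends
   x (x) s to (x_(1,a) (x) b s) (x) (x_(2,b) (x) s); {malg k[G]} is kG. *)
Definition smash_insert (s : G) (c : C a) (d : C b) :
    tens (smash_space a) (smash_space b) :=
  pure (pure c << (b * s)%g >>) (pure d << s >>).

Fact smash_insert_bilinear s : bilinear_for *:%R *:%R (smash_insert s).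
Proof.
by split=> [d e c c'|c e d d']; rewrite /smash_insert !linearPl ?linearPr.
Qed.

HB.instance Definition _ s :=
  bilinear_isBilinear.Build k (C a) (C b) (tens (smash_space a) (smash_space b))
    *:%R *:%R (smash_insert s) (smash_insert_bilinear s).

Lemma smash_insertE s c d : tens_lift (smash_insert s) (pure c d) =
  pure (pure c << (b * s)%g >>) (pure d << s >>).
Proof. exact: tens_liftE. Qed.

Definition smash_comul_map (c : C (a * b)%g) (g : {malg k[G]}) :
    tens (smash_space a) (smash_space b) :=
  malg_ext (fun s => tens_lift (smash_insert s) (gc_comul C a b c)) g.

Fact smash_comul_map_bilinear : bilinear_for *:%R *:%R smash_comul_map.
Proof.
split=> [g e c c'|c e g g'] /=; last by rewrite /smash_comul_map linearP.
rewrite /smash_comul_map !malg_ext.unlock scaler_sumr -big_split /=.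
apply: eq_bigr => s _.
by rewrite !linearP.
Qed.

HB.instance Definition _ :=
  bilinear_isBilinear.Build k (C (a * b)%g) {malg k[G]}
    (tens (smash_space a) (smash_space b)) *:%R *:%R smash_comul_map
    smash_comul_map_bilinear.

Definition smash_comul :
    {linear smash_space (a * b)%g -> tens (smash_space a) (smash_space b)} :=
  tens_lift smash_comul_map.
Arguments smash_comul : simpl never.

Lemma smash_comulE c s :
  smash_comul (pure c << s >>) = tens_lift (smash_insert s) (gc_comul C a b c).
Proof. by rewrite /smash_comul /= tens_liftE /= /smash_comul_map malg_extU. Qed.
End Comul.
Arguments smash_comul : simpl never.

Definition smash_counit_map (c : C 1%g) (g : {malg k[G]}) : k^o :=
  malg_ext (fun=> gc_counit C c) g.

Fact smash_counit_map_bilinear : bilinear_for *:%R *:%R smash_counit_map.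
Proof.
split=> [g e c c'|c e g g'] /=; last by rewrite /smash_counit_map linearP.
rewrite /smash_counit_map !malg_ext.unlock scaler_sumr -big_split /=.
by apply: eq_bigr => s _; rewrite !linearP.
Qed.

HB.instance Definition _ :=
  bilinear_isBilinear.Build k (C 1%g) {malg k[G]} k^o *:%R *:%R smash_counit_map
    smash_counit_map_bilinear.

Definition smash_counit : {linear smash_space 1%g -> k^o} :=
  tens_lift smash_counit_map.
Arguments smash_counit : simpl never.

Lemma smash_counitE c s : smash_counit (pure c << s >>) = gc_counit C c.
Proof. by rewrite /smash_counit /= tens_liftE /= /smash_counit_map malg_extU. Qed.

Lemma smash_ind a (P : smash_space a -> Prop) :
  P 0 -> (forall e x y, P x -> P y -> P (e *: x + y)) ->
  (forall c s, P (pure c << s >>)) -> forall x, P x.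
Proof.
move=> P0 PP Pm; apply: tens_ind => [||c g]; [exact: P0|exact: PP|].
rewrite [g]monalgE linear_sumr /=.
apply: (big_ind P) => // [y z Py Pz|s _]; first by rewrite -[y]scale1r; apply: PP.
by rewrite malgUZ linearZr -[X in P X]addr0; apply: PP; [apply: Pm|].
Qed.

Lemma ecast0 (F : G -> lmodType k) a b (e : a = b) :
  ecast i (F i) e 0 = 0.
Proof. by case: _ / e. Qed.

Lemma ecastP (F : G -> lmodType k) a b (e : a = b) d (x y : F a) :
  ecast i (F i) e (d *: x + y) = d *: ecast i (F i) e x + ecast i (F i) e y.
Proof. by case: _ / e. Qed.

Lemma ecast_smash a b (e : a = b) c g :
  ecast i (smash_space i) e (pure c g) = pure (ecast i (C i) e c) g.
Proof. by case: _ / e. Qed.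

Fact smash_coassoc (a b c : G) (x : smash_space (a * b * c)%g) :
  tassoc (tmap (smash_comul a b) idfun (smash_comul (a * b)%g c x)) =
  tmap idfun (smash_comul b c)
    (smash_comul a (b * c)%g (ecast i (smash_space i) (esym (mulgA a b c)) x)).
Proof.
elim/smash_ind: x => [|d x y hx hy|x s].
- by rewrite (@ecast0 smash_space) !linear0.
- by rewrite (@ecastP smash_space) !linearP /= hx hy.
rewrite ecast_smash !smash_comulE.
pose ins (p : C a) : smash_space a := pure p << (b * c * s)%g >>.
have ins_lin : linear ins by move=> d p q; rewrite /ins linearPl.
pose insL : {linear C a -> smash_space a} :=
  HB.pack ins (GRing.isLinear.Build k _ _ _ ins ins_lin).
pose Psi := tmap insL (tens_lift (@smash_insert b c s)).
transitivity (Psi (tassoc (tmap (gc_comul C a b) idfun (gc_comul C (a * b)%g c x)))).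
  move: (gc_comul C (a * b)%g c x); apply: (@tens_ind k) => [|d u v hu hv|u w].
  - by rewrite !linear0.
  - by rewrite !linearP /= hu hv.
  rewrite smash_insertE !tmapE smash_comulE /=.
  move: (gc_comul C a b u); apply: (@tens_ind k) => [|d p q hp hq|p q].
  - by rewrite !(linear0, linear0l).
  - by rewrite !(linearP, linearPl) /= hp hq.
  rewrite smash_insertE !tassocE /Psi tmapE [X in _ = pure _ X]smash_insertE.
  by rewrite mulgA.
rewrite gc_coassoc; move: (gc_comul C a _ _); apply: (@tens_ind k) => [|d u v hu hv|u w].
- by rewrite !linear0.
- by rewrite !linearP /= hu hv.
rewrite smash_insertE !tmapE smash_comulE /=.
by [].
Qed.

Fact smash_counitr (a : G) (x : smash_space (a * 1)%g) :
  tunitr (tmap idfun smash_counit (smash_comul a 1%g x)) =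
  ecast i (smash_space i) (mulg1 a) x.
Proof.
elim/smash_ind: x => [|d x y hx hy|x s].
- by rewrite (@ecast0 smash_space) !linear0.
- by rewrite (@ecastP smash_space) !linearP /= hx hy.
rewrite ecast_smash smash_comulE -gc_counitr.
move: (gc_comul C a _ x); apply: (@tens_ind k) => [|d u v hu hv|u w].
- by rewrite !(linear0, linear0l).
- by rewrite !(linearP, linearPl) /= hu hv.
rewrite smash_insertE !tmapE smash_counitE !tunitrE /= mul1g.
by rewrite linearZl.
Qed.

Fact smash_counitl (a : G) (x : smash_space (1 * a)%g) :
  tunitl (tmap smash_counit idfun (smash_comul 1%g a x)) =
  ecast i (smash_space i) (mul1g a) x.
Proof.
elim/smash_ind: x => [|d x y hx hy|x s].
- by rewrite (@ecast0 smash_space) !linear0.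
- by rewrite (@ecastP smash_space) !linearP /= hx hy.
rewrite ecast_smash smash_comulE -gc_counitl.
move: (gc_comul C _ a x); apply: (@tens_ind k) => [|d u v hu hv|u w].
- by rewrite !(linear0, linear0l).
- by rewrite !(linearP, linearPl) /= hu hv.
rewrite smash_insertE !tmapE smash_counitE !tunitlE /=.
by rewrite linearZl.
Qed.

Definition smash_coproduct : gcoalgebra G k := GCoalgebra
  smash_coassoc smash_counitr smash_counitl.
End SmashCoproduct.

Record category := Category {
  obj :> Type;
  hom : obj -> obj -> Type;
  cat_id : forall X, hom X X;
  cat_comp : forall X Y Z, hom Y Z -> hom X Y -> hom X Z;
  cat_idl : forall X Y (f : hom X Y), cat_comp (cat_id Y) f = f;
  cat_idr : forall X Y (f : hom X Y), cat_comp f (cat_id X) = f;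
  cat_compA : forall W X Y Z (h : hom Y Z) (g : hom X Y) (f : hom W X),
    cat_comp h (cat_comp g f) = cat_comp (cat_comp h g) f
}.

Record functor (C D : category) := Functor {
  fobj :> C -> D;
  fmap : forall X Y : C, hom X Y -> hom (fobj X) (fobj Y);
  fmap_id : forall X, fmap (cat_id X) = cat_id (fobj X);
  fmap_comp : forall (X Y Z : C) (g : hom Y Z) (f : hom X Y),
    fmap (cat_comp g f) = cat_comp (fmap g) (fmap f)
}.

Definition functor_id (C : category) : functor C C :=
  @Functor C C id (fun X Y f => f) (fun=> erefl) (fun _ _ _ _ _ => erefl).

Section FunctorComp.
Variables (C D E : category) (G : functor D E) (F : functor C D).

Fact functor_comp_id X :
  fmap G (fmap F (cat_id X)) = cat_id (G (F X)).
Proof. by rewrite !fmap_id. Qed.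

Fact functor_comp_comp (X Y Z : C) (g : hom Y Z) (f : hom X Y) :
  fmap G (fmap F (cat_comp g f)) =
  cat_comp (fmap G (fmap F g)) (fmap G (fmap F f)).
Proof. by rewrite !fmap_comp. Qed.

Definition functor_comp : functor C E :=
  @Functor C E (fun X => G (F X)) (fun X Y f => fmap G (fmap F f))
    functor_comp_id functor_comp_comp.
End FunctorComp.

Definition cat_isomorphic (C D : category) : Prop :=
  exists (F : functor C D) (G : functor D C),
    functor_comp G F = functor_id C /\ functor_comp F G = functor_id D.

(* [cat_isomorphic] compares objects with [=].  Equality of bare types is mostly
   undetermined in Rocq, so for it to mean what it means in set theory the
   elements of a vector space have to be sets: [uset] is the universe of
   well-founded sets, presented as trees, and an object is carried by a vector
   space together with an injective [elem] telling which set each element is.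
   Every lmodType can be so named; the names do not enter the structure maps nor
   the morphisms, only the identity of objects. *)
Inductive uset : Type := Uset (I : Type) of (I -> uset).

Record vspace (k : fieldType) := Vspace {
  vspace_lmod :> lmodType k;
  elem : vspace_lmod -> uset;
  elem_inj : injective elem
}.

Lemma tmapl_comp (k : fieldType) (M M' M'' N : lmodType k)
    (g : {linear M' -> M''}) (f : {linear M -> M'}) (x : tens M N) :
  tmap (g \o f : {linear M -> M''}) idfun x = tmap g idfun (tmap f idfun x).
Proof.
move: x; apply: (@tens_ind k) => [|a x y hx hy|m n]; first by rewrite !linear0.
  by rewrite !linearP /= hx hy.
by rewrite !tmapE.
Qed.

Section Comodules.
Variables (G : groupType) (k : fieldType) (D : gcoalgebra G k).

Record comodule := Comodule {
  cm_space :> vspace k;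
  cm_coact : forall a : G, {linear cm_space -> tens cm_space (D a)};
  cm_counit : forall m : cm_space,
    tunitr (tmap idfun (gc_counit D) (cm_coact 1%g m)) = m;
  cm_coassoc : forall (a b : G) (m : cm_space),
    tmap idfun (gc_comul D a b) (cm_coact (a * b)%g m) =
    tassoc (tmap (cm_coact a) idfun (cm_coact b m))
}.

Record comodule_hom (M N : comodule) := ComoduleHom {
  cm_map :> {linear M -> N};
  cm_mapP : forall (a : G) (m : M),
    tmap cm_map idfun (cm_coact M a m) = cm_coact N a (cm_map m)
}.

Lemma comodule_hom_eq (M N : comodule) (f g : comodule_hom M N) : f =1 g -> f = g.
Proof.
case: f g => [f fP] [g gP] /= /linear_eq fg; subst g.
by congr ComoduleHom; apply: Prop_irrelevance.
Qed.

Definition comodule_id (M : comodule) : comodule_hom M M :=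
  @ComoduleHom M M idfun (fun a m => tmap_id _).

Fact comodule_comp_subproof (M N P : comodule) (g : comodule_hom N P)
    (f : comodule_hom M N) (a : G) (m : M) :
  tmap (g \o f : {linear M -> P}) idfun (cm_coact M a m) =
  cm_coact P a ((g \o f : {linear M -> P}) m).
Proof. by rewrite tmapl_comp !cm_mapP. Qed.

Definition comodule_comp (M N P : comodule) (g : comodule_hom N P)
    (f : comodule_hom M N) : comodule_hom M P :=
  ComoduleHom (comodule_comp_subproof g f).

Program Definition comodule_cat : category :=
  @Category comodule comodule_hom comodule_id comodule_comp _ _ _.
Next Obligation. by apply: comodule_hom_eq. Qed.
Next Obligation. by apply: comodule_hom_eq. Qed.
Next Obligation. by apply: comodule_hom_eq. Qed.
End Comodules.

Section GComodules.
Variables (G : groupType) (k : fieldType) (C : gcoalgebra G k).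

Record gcomodule := GComodule {
  gm_space :> G -> vspace k;
  gm_coact : forall a b : G,
    {linear gm_space (a * b)%g -> tens (gm_space a) (C b)};
  gm_counit : forall (a : G) (m : gm_space (a * 1)%g),
    tunitr (tmap idfun (gc_counit C) (gm_coact a 1%g m)) =
    ecast i (gm_space i) (mulg1 a) m;
  gm_coassoc : forall (a b c : G) (m : gm_space (a * b * c)%g),
    tassoc (tmap (gm_coact a b) idfun (gm_coact (a * b)%g c m)) =
    tmap idfun (gc_comul C b c)
      (gm_coact a (b * c)%g (ecast i (gm_space i) (esym (mulgA a b c)) m))
}.

Record gcomodule_hom (M N : gcomodule) := GComoduleHom {
  gm_map :> forall a : G, {linear M a -> N a};
  gm_mapP : forall (a b : G) (m : M (a * b)%g),
    tmap (gm_map a) idfun (gm_coact M a b m) = gm_coact N a b (gm_map (a * b)%g m)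
}.

Lemma gcomodule_hom_eq (M N : gcomodule) (f g : gcomodule_hom M N) :
  (forall a, f a =1 g a) -> f = g.
Proof.
case: f g => [f fP] [g gP] /= fg.
have {}fg : f = g by apply: functional_extensionality_dep => a; apply: linear_eq; apply: fg.
by subst g; congr GComoduleHom; apply: Prop_irrelevance.
Qed.

Definition gcomodule_id (M : gcomodule) : gcomodule_hom M M :=
  @GComoduleHom M M (fun=> idfun) (fun a b m => tmap_id _).

Fact gcomodule_comp_subproof (M N P : gcomodule) (g : gcomodule_hom N P)
    (f : gcomodule_hom M N) (a b : G) (m : M (a * b)%g) :
  tmap (g a \o f a : {linear M a -> P a}) idfun (gm_coact M a b m) =
  gm_coact P a b
    ((g (a * b)%g \o f (a * b)%g : {linear M (a * b)%g -> P (a * b)%g}) m).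
Proof. by rewrite tmapl_comp !gm_mapP. Qed.

Definition gcomodule_comp (M N P : gcomodule) (g : gcomodule_hom N P)
    (f : gcomodule_hom M N) : gcomodule_hom M P :=
  @GComoduleHom M P (fun a => g a \o f a) (gcomodule_comp_subproof g f).

Program Definition gcomodule_cat : category :=
  @Category gcomodule gcomodule_hom gcomodule_id gcomodule_comp _ _ _.
Next Obligation. by apply: gcomodule_hom_eq. Qed.
Next Obligation. by apply: gcomodule_hom_eq. Qed.
Next Obligation. by apply: gcomodule_hom_eq. Qed.
End GComodules.

(* Main.v *)
Require Import Defs.
From mathcomp Require Import all_boot all_order all_algebra.
From HB Require Import structures.
From mathcomp Require Import boolp.
From mathcomp.multinomials Require Import monalg.

Set Implicit Arguments.
Unset Strict Implicit.
Unset Printing Implicit Defensive.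

(* Reopens the definitions, whose [hom] is hidden by the one of vector.v. *)
Import Defs.
Import GRing.Theory.
Local Open Scope ring_scope.

(** Write D for the smash coproduct of C with kG.  A D-comodule M is the same
    thing as a G-C-comodule N, up to isomorphism: the comultiplication of D
    forces M to be G-graded.  Indeed, collecting the terms of rho_1(m) whose
    second tensor factor lies in C_1 (x) s and applying the counit of C yields
    an endomorphism P_s of M ([grade]).  Coassociativity says that rho_b(P_s m)
    is the part of rho_b(m) lying over s ([coact_grade]), which is also the
    part whose first tensor factor lies in the image of P_(b s)
    ([grade_coact]).  So the P_s are orthogonal idempotents, they sum to the
    identity by [assemble_id], and with N_g the image of P_(g^-1) the coaction
    rho_b restricts to N_(a b) -> N_a (x) C_b (x) (a b)^-1, which is a
    G-C-comodule structure.  Conversely the direct sum of the components of a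
    G-C-comodule, with (a b)^-1 inserted in the coaction, is a D-comodule.

    Both constructions are instances of one relation, [is_decomposition N M]:
    M is a coproduct of the N_g by injections compatible with the coactions.
    Every M and every N takes part in it ([gcomodule_of_comodule],
    [comodule_of_gcomodule]), and a choice of decompositions of M and M'
    identifies Hom(M, M') with Hom(N, N') ([comodule_hom_of],
    [gcomodule_hom_of]).

    The two constructions are inverse to each other only up to isomorphism,
    whereas an isomorphism of categories is a bijection on objects.  It is
    obtained by counting.  The relation cuts the two classes of objects into
    matching blocks, and all blocks are equinumerous with the class [uset] of
    sets: an object can be coded by a set ([coded_comodule],
    [coded_gcomodule]), and changing only the names of the vectors of an object
    gives as many objects of the same block as there are sets
    ([comodule_many], [gcomodule_many]).  So the Cantor-Bernstein theorem
    provides a bijection N |-> F N with F N decomposed by N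
    ([matching_bijection]), and the identification of the morphisms turns F
    into a fully faithful functor, hence into an isomorphism of categories
    ([fully_faithful_bijective_isomorphic]). *)

(** * Coding objects by sets *)

Lemma existT_inj2 (A : Type) (P : A -> Type) (a : A) (x y : P a) :
  existT P a x = existT P a y -> x = y.
Proof.
by move=> e; have := projT2_eq e; rewrite (Prop_irrelevance (projT1_eq e) erefl).
Qed.

(** Two trees over the same index type have equal branches: equality of index
    types lives in [Prop], hence is proof-irrelevant. *)
Lemma Uset_inj I : injective (@Uset I).
Proof.
by move=> f g e; injection e; apply: existT_inj2.
Qed.

(** [X] is no larger than the class of all sets. *)
Definition coded (X : Type) : Prop := exists f : X -> uset, injective f.

Lemma coded_inj (X Y : Type) (f : X -> Y) : injective f -> coded Y -> coded X.
Proof. by move=> f_inj [c c_inj]; exists (c \o f); apply: inj_comp. Qed.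

Definition uset0 : uset := Uset (fun x : False => match x with end).
Definition uset1 : uset := Uset (fun _ : True => uset0).

Lemma uset1_neq0 : uset1 <> uset0.
Proof.
move=> /(congr1 (fun t : uset => match t with Uset J _ => exists _ : J, True end)) /= e.
by have [] : exists _ : False, True by rewrite -e; exists I.
Qed.

(** The elements of [X] are told apart by their characteristic functions, and
    functions from [X] to sets are trees.  Here [X] lies in the universe of the
    index types of [uset], as do carriers of vector spaces and spaces of linear
    maps between them. *)
Lemma coded_small (X : Type) : coded X.
Proof.
exists (fun x => Uset (fun y : X => if `[< y = x >] then uset1 else uset0)).
move=> x y /Uset_inj /(congr1 (@^~ x)).
by case: asboolP => // _; case: asboolP => // _ /uset1_neq0.
Qed.

(** A tree records its index type, so that even the universe of index types,
    which is not an index type itself, is coded.  This is what bounds the number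
    of carriers of vector spaces, although nothing is known about when two types
    are equal. *)
Lemma coded_Type : coded Type.
Proof. by exists (fun T : Type => Uset (fun _ : T => uset0)) => T T' []. Qed.

Lemma coded_fun (I Y : Type) : coded Y -> coded (I -> Y).
Proof.
move=> [c c_inj]; exists (fun f => Uset (c \o f)) => f g /Uset_inj e.
by apply/funext => i; apply: c_inj; exact: (congr1 (@^~ i) e).
Qed.

Definition uset_pair (s t : uset) : uset :=
  Uset (fun b : bool => if b then s else t).

Lemma uset_pair_inj s t s' t' :
  uset_pair s t = uset_pair s' t' -> s = s' /\ t = t'.
Proof.
by move=> /Uset_inj e; split;
  [exact: (congr1 (@^~ true) e) | exact: (congr1 (@^~ false) e)].
Qed.

Lemma coded_sigT (A : Type) (B : A -> Type) :
  coded A -> (forall a, coded (B a)) -> coded {a & B a}.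
Proof.
move=> [c c_inj] cB; pose d a := sval (cid (cB a)).
have d_inj a : injective (d a) := svalP (cid (cB a)).
exists (fun x => uset_pair (c (projT1 x)) (d _ (projT2 x))) => -[a b] [a' b'] /=.
move=> /uset_pair_inj [/c_inj e]; subst a' => /d_inj e; congr existT; exact: e.
Qed.

Lemma coded_lmodType (k : fieldType) : coded (lmodType k).
Proof.
apply: (@coded_inj _ {T : Type & GRing.Lmodule.axioms_ k T}
  (fun V => existT _ (GRing.Lmodule.sort V) (GRing.Lmodule.class V))).
  by move=> [T c] [T' c'] /= e; case: e => e; subst T' => h; rewrite (existT_inj2 h).
by apply: coded_sigT => [|T]; [exact: coded_Type | exact: coded_small].
Qed.

Lemma coded_vspace (k : fieldType) : coded (vspace k).
Proof.
apply: (@coded_inj _ {V : lmodType k & V -> uset}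
  (fun V => existT (fun V : lmodType k => V -> uset) (vspace_lmod V) (@elem k V))).
  move=> [V f f_inj] [V' f' f'_inj] /= e; case: e => e; subst V' => /= h.
  have e := existT_inj2 h.
  by subst f'; congr Vspace; apply: Prop_irrelevance.
apply: coded_sigT => [|V]; first exact: coded_lmodType.
by apply: coded_fun; exists id.
Qed.

Section Coded.
Variables (G : groupType) (k : fieldType) (C : gcoalgebra G k).

Lemma coded_comodule : coded (comodule C).
Proof.
apply: (@coded_inj _ {V : vspace k & forall a : G, {linear V -> tens V (C a)}}
  (fun M => existT (fun V : vspace k => forall a : G, {linear V -> tens V (C a)})
     (cm_space M) (@cm_coact G k C M))).
  move=> [V r p q] [V' r' p' q'] /= e; case: e => e; subst V' => /= h.
  have e := existT_inj2 h.
  by subst r'; congr Comodule; apply: Prop_irrelevance.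
by apply: coded_sigT => [|V]; [exact: coded_vspace | exact: coded_small].
Qed.

Lemma coded_gcomodule : coded (gcomodule C).
Proof.
apply: (@coded_inj _ {V : G -> vspace k & forall a b : G, {linear V (a * b)%g -> tens (V a) (C b)}}
  (fun M => existT (fun V : G -> vspace k => forall a b : G, {linear V (a * b)%g -> tens (V a) (C b)})
     (gm_space M) (@gm_coact G k C M))).
  move=> [V r p q] [V' r' p' q'] /= e; case: e => e; subst V' => /= h.
  have e := existT_inj2 h.
  by subst r'; congr GComodule; apply: Prop_irrelevance.
apply: coded_sigT => [|V]; last exact: coded_small.
by apply: coded_fun; exact: coded_vspace.
Qed.
End Coded.

(** * Matching two classes of objects *)

(** The points reached by alternating [f] and [g] from a point outside the image
    of [g], as in the proof of the Cantor-Bernstein theorem. *)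
Inductive orphan_line (X Y : Type) (f : X -> Y) (g : Y -> X) : X -> Prop :=
| Orphan x : (forall y, g y <> x) -> orphan_line f g x
| OrphanNext x : orphan_line f g x -> orphan_line f g (g (f x)).

(** Cantor-Bernstein for bare types: follow [f] on the lines that start with a
    point without preimage under [g], and the inverse of [g] elsewhere.  It is
    applied to types of objects, which live in a universe too large for
    [eqType]. *)
Lemma injections_bijection (X Y : Type) (f : X -> Y) (g : Y -> X) :
  injective f -> injective g ->
  exists h : X -> Y, injective h /\ forall y, exists x, h x = y.
Proof.
move=> f_inj g_inj.
pose S := orphan_line f g.
have /choice[h hP] : forall x, exists y, (S x /\ y = f x) \/ (~ S x /\ g y = x).
  move=> x; have [Sx|nSx] := pselect (S x); first by exists (f x); left.
  have [[y gy]|ngy] := pselect (exists y, g y = x); first by exists y; right.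
  by case: nSx; apply: Orphan => y gy; apply: ngy; exists y.
exists h; split=> [x x' e|y].
  case: (hP x) (hP x') => -[Sx ex] [] [Sx' ex'].
  - by apply: f_inj; rewrite -ex -ex' e.
  - by case: Sx'; rewrite -ex' -e ex; exact: OrphanNext.
  - by case: Sx; rewrite -ex e ex'; exact: OrphanNext.
  - by rewrite -ex -ex' e.
have [Sy|nSy] := pselect (S (g y)); last first.
  by exists (g y); case: (hP (g y)) => [[/nSy]|[_ /g_inj]].
case: {-1}_ / Sy (erefl (g y)) => [x xP /xP //|x Sx /g_inj ey]; exists x.
by case: (hP x) => [[_ ->]|[]].
Qed.

Definition bijective_on (X U : Type) (A : X -> Prop) (f : X -> U) : Prop :=
  (forall x x', A x -> A x' -> f x = f x' -> x = x') /\
  (forall u, exists2 x, A x & f x = u).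

Definition contains_many (U X : Type) (A : X -> Prop) : Prop :=
  exists2 r : U -> X, injective r & forall u, A (r u).

Lemma coded_numbers (X : Type) (A : X -> Prop) :
  coded X -> contains_many uset A -> exists f : X -> uset, bijective_on A f.
Proof.
move=> [c c_inj] [r r_inj rA].
pose r' u : {x | A x} := exist _ (r u) (rA u).
have c_inj' : injective (fun x : {x | A x} => c (sval x)).
  move=> [x Ax] [x' Ax'] /= /c_inj e; subst x'; congr exist; exact: Prop_irrelevance.
have r_inj' : injective r' by move=> u v [] /r_inj.
have [h [h_inj h_surj]] := injections_bijection c_inj' r_inj'.
exists (fun x => if pselect (A x) is left Ax then h (exist _ x Ax) else uset0).
split=> [x x' Ax Ax'|u].
  by case: pselect => // a; case: pselect => // a' /h_inj [].
have [[x Ax] <-] := h_surj u; exists x => //.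
by case: pselect => // a; rewrite (Prop_irrelevance a Ax).
Qed.

Lemma numbering (T : Type) : coded T -> exists n : (T -> Prop) -> T -> uset,
  forall A, contains_many uset A -> bijective_on A (n A).
Proof.
move=> cT.
have /choice[n nP] : forall A : T -> Prop, exists f : T -> uset,
    contains_many uset A -> bijective_on A f.
  move=> A; have [/(coded_numbers cT) [f fP]|nA] := pselect (contains_many uset A).
    by exists f.
  by exists (fun=> uset0).
by exists n.
Qed.

(** A total difunctional relation cuts [X] and [Y] into matching blocks.  Each
    block has exactly as many elements as there are sets, so that the elements of
    matching blocks can be paired. *)
Section Matching.
Variables (X Y : Type) (R : X -> Y -> Prop).
Hypotheses (coded_X : coded X) (coded_Y : coded Y).
Hypotheses (total_l : forall x, exists y, R x y) (total_r : forall y, exists x, R x y).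
Hypothesis difunctional : forall x x' y y', R x y -> R x' y -> R x' y' -> R x y'.
Hypothesis many_l : forall x y, R x y -> contains_many uset (R^~ y).
Hypothesis many_r : forall x y, R x y -> contains_many uset (R x).

(** Each block is numbered by [uset], by a numbering that depends on the block
    alone; [x] and [y] are paired when they lie in matching blocks and have the
    same number there. *)
Lemma matching_bijection :
  exists (f : X -> Y) (g : Y -> X), [/\ cancel f g, cancel g f & forall x, R x (f x)].
Proof.
have [nX nXP] := numbering coded_X; have [nY nYP] := numbering coded_Y.
pose P x y := R x y /\ nX (R^~ y) x = nY (R x) y.
have row x x' y : R x y -> R x' y -> R x = R x'.
  move=> xy x'y; apply/funext => z; apply/propext.
  by split; [exact: (difunctional x'y xy) | exact: (difunctional xy x'y)].
have col x y y' : R x y -> R x y' -> R^~ y = R^~ y'.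
  move=> xy xy'; apply/funext => z; apply/propext.
  by split=> zy; [exact: (difunctional zy xy) | exact: (difunctional zy xy')].
have /choice[f fP] : forall x, exists y, P x y.
  move=> x; have [y0 xy0] := total_l x.
  have [_ /(_ (nX (R^~ y0) x))[y xy ny]] := nYP _ (many_r xy0).
  by exists y; split => //; rewrite ny (col _ _ _ xy xy0).
have /choice[g gP] : forall y, exists x, P x y.
  move=> y; have [x0 x0y] := total_r y.
  have [_ /(_ (nY (R x0) y))[x xy nx]] := nXP _ (many_l x0y).
  by exists x; split => //; rewrite nx (row _ _ _ xy x0y).
have P_fun x y y' : P x y -> P x y' -> y = y'.
  move=> [xy e] [xy' e']; apply: (proj1 (nYP _ (many_r xy))) => //.
  by rewrite -e -e' (col _ _ _ xy xy').
have P_inj x x' y : P x y -> P x' y -> x = x'.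
  move=> [xy e] [x'y e']; apply: (proj1 (nXP _ (many_l xy))) => //.
  by rewrite e e' (row _ _ _ xy x'y).
exists f, g; split=> [x|y|x]; last by case: (fP x).
- exact: P_inj (gP (f x)) (fP x).
- exact: P_fun (fP (g y)) (gP y).
Qed.
End Matching.

(** * Functors that are bijective on objects *)

(** Equality of functors, with morphisms compared along given equalities of the
    objects.  These equalities become reflexivity once the object maps are
    identified, which is possible because proofs of equality are irrelevant. *)
Lemma functor_eq (C D : category) (F F' : functor C D)
    (e : forall X, F X = F' X) :
  (forall (X Y : C) (f : hom X Y),
     ecast A (hom A (F' Y)) (e X) (ecast B (hom (F X) B) (e Y) (fmap F f)) =
     fmap F' f) -> F = F'.
Proof.
case: F F' e => [F Ff F1 FM] [F' Ff' F1' FM'] /= e.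
have eF : F = F' by apply/funext.
subst F' => h.
have eFf : Ff = Ff'.
  apply: functional_extensionality_dep => X; apply: functional_extensionality_dep => Y.
  apply/funext => f; rewrite -h.
  by rewrite (Prop_irrelevance (e X) erefl) (Prop_irrelevance (e Y) erefl).
by subst Ff'; congr Functor; apply: Prop_irrelevance.
Qed.

Section BijectiveFullyFaithful.
Variables (C D : category) (F : functor C D) (b : D -> C).
Hypotheses (FK : cancel F b) (bK : cancel b F).
Hypothesis fmap_bij : forall X Y : C, bijective (@fmap C D F X Y).

Let finv (X Y : C) (g : hom (F X) (F Y)) : hom X Y :=
  sval (cid (let: Bijective f _ fK := fmap_bij X Y in
    ex_intro (fun f => fmap F f = g) (f g) (fK g))).

Let finvK (X Y : C) : cancel (@finv X Y) (@fmap C D F X Y).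
Proof. by move=> g; rewrite /finv; case: cid. Qed.

Let fmap_inj (X Y : C) : injective (@fmap C D F X Y) := bij_inj (fmap_bij X Y).

Let hcast (E : category) (X X' Y Y' : E) (eX : X = X') (eY : Y = Y')
    (f : hom X Y) : hom X' Y' :=
  ecast A (hom A Y') eX (ecast B (hom X B) eY f).

(* The inverse functor on morphisms: a morphism of [D] is first moved to the
   equal objects [F (b X)] and [F (b Y)]. *)
Let bmap (X Y : D) (g : hom X Y) : hom (b X) (b Y) :=
  finv (hcast (esym (bK X)) (esym (bK Y)) g).

Let bmap_id X : bmap (cat_id X) = cat_id (b X).
Proof.
apply: fmap_inj; rewrite finvK fmap_id.
by move: (F (b X)) (esym (bK X)) => A e; case: A / e.
Qed.

Let bmap_comp (X Y Z : D) (g : hom Y Z) (f : hom X Y) :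
  bmap (cat_comp g f) = cat_comp (bmap g) (bmap f).
Proof.
apply: fmap_inj; rewrite fmap_comp !finvK.
move: (F (b X)) (esym (bK X)) => X' e; case: X' / e.
move: (F (b Y)) (esym (bK Y)) => Y' e; case: Y' / e.
by move: (F (b Z)) (esym (bK Z)) => Z' e; case: Z' / e.
Qed.

Let hcast_esym (E : category) (X X' Y Y' : E) (eX : X = X') (eY : Y = Y') (f : hom X' Y') :
  hcast eX eY (hcast (esym eX) (esym eY) f) = f.
Proof. by move: f; case: _ / eX; case: _ / eY. Qed.

Let fmap_hcast (X X' Y Y' : C) (eX : X = X') (eY : Y = Y') (f : hom X Y) :
  fmap F (hcast eX eY f) = hcast (congr1 F eX) (congr1 F eY) (fmap F f).
Proof. by case: _ / eX; case: _ / eY. Qed.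

Lemma fully_faithful_bijective_isomorphic : cat_isomorphic C D.
Proof.
pose B := Functor bmap_id bmap_comp; exists F, B; split.
  apply: (@functor_eq _ _ (functor_comp B F) (functor_id C) FK) => X Y f.
  apply: fmap_inj; rewrite /= -/(hcast _ _ _) fmap_hcast finvK.
  rewrite (Prop_irrelevance (congr1 F (FK X)) (bK (F X))).
  by rewrite (Prop_irrelevance (congr1 F (FK Y)) (bK (F Y))) hcast_esym.
apply: (@functor_eq _ _ (functor_comp F B) (functor_id D) bK) => X Y f.
by rewrite /= finvK -/(hcast _ _ _) hcast_esym.
Qed.
End BijectiveFullyFaithful.

(** * Tensor products *)

Section Tensor.
Variable k : fieldType.

Lemma tmap_eq (M N M' N' : lmodType k) (f f' : {linear M -> M'}) (g g' : {linear N -> N'}) :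
  f =1 f' -> g =1 g' -> tmap f g =1 tmap f' g'.
Proof. by move=> ef eg; apply: tens_eq => m n; rewrite !tmapE ef eg. Qed.

(** Functoriality of the tensor product, in the form in which it is used most:
    a pair of commutative squares. *)
Lemma tmap_square (M M1 M2 M' N N1 N2 N' : lmodType k)
    (f1 : {linear M -> M1}) (f1' : {linear M1 -> M'})
    (f2 : {linear M -> M2}) (f2' : {linear M2 -> M'})
    (g1 : {linear N -> N1}) (g1' : {linear N1 -> N'})
    (g2 : {linear N -> N2}) (g2' : {linear N2 -> N'}) :
  (forall m, f1' (f1 m) = f2' (f2 m)) -> (forall n, g1' (g1 n) = g2' (g2 n)) ->
  forall x, tmap f1' g1' (tmap f1 g1 x) = tmap f2' g2' (tmap f2 g2 x).
Proof.
move=> ef eg.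
by apply: (@tens_eq _ _ _ _ (tmap f1' g1' \o tmap f1 g1) (tmap f2' g2' \o tmap f2 g2))
  => m n /=; rewrite !tmapE ef eg.
Qed.

Lemma tmap_comp (M M1 M' N N1 N' : lmodType k)
    (f : {linear M -> M1}) (f' : {linear M1 -> M'}) (h : {linear M -> M'})
    (g : {linear N -> N1}) (g' : {linear N1 -> N'}) (l : {linear N -> N'}) :
  (forall m, f' (f m) = h m) -> (forall n, g' (g n) = l n) ->
  forall x, tmap f' g' (tmap f g x) = tmap h l x.
Proof.
move=> ef eg x; rewrite -[RHS]tmap_id.
by apply: tmap_square => [m|n] /=; rewrite ?ef ?eg.
Qed.

Lemma tassoc_natural (A A' B B' C C' : lmodType k)
    (f : {linear A -> A'}) (g : {linear B -> B'}) (h : {linear C -> C'}) x :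
  tassoc (tmap (tmap f g) h x) = tmap f (tmap g h) (tassoc x).
Proof.
move: x; apply: (@tens_ind k) => [|d u v hu hv|u c]; first by rewrite !linear0.
  by rewrite !linearP /= hu hv.
move: u; apply: (@tens_ind k) => [|d u v hu hv|a b]; first by rewrite linear0l !linear0.
  by rewrite linearPl !linearP /= hu hv.
by rewrite !tmapE !tassocE !tmapE.
Qed.

Lemma tunitr_natural (M M' : lmodType k) (f : {linear M -> M'}) x :
  tunitr (tmap f idfun x) = f (tunitr x).
Proof.
move: x; apply: (@tens_ind k) => [|d u v hu hv|u c]; first by rewrite !linear0.
  by rewrite !linearP /= hu hv.
by rewrite tmapE !tunitrE linearZ.
Qed.

Lemma tmap_inj (M N M' N' : lmodType k) (f : {linear M -> M'}) (g : {linear N -> N'})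
   (f' : {linear M' -> M}) (g' : {linear N' -> N}) :
  cancel f f' -> cancel g g' -> injective (tmap f g).
Proof.
move=> fK gK; apply: (@can_inj _ _ _ (tmap f' g')) => x.
by rewrite -[RHS]tmap_id; apply: tmap_comp.
Qed.

(** Linear maps V (x) kK -> W are families of linear maps V -> W indexed by K.
    Infinite sums over K never need to be written: they are hidden in
    this universal property. *)
Section Slices.
Variables (K : choiceType) (V W : lmodType k) (h : K -> {linear V -> W}).

Definition slices_map (v : V) (x : {malg k[K]}) : W := malg_ext (fun s => h s v) x.

Fact slices_map_bilinear : bilinear_for *:%R *:%R slices_map.
Proof.
split=> [x a v v'|v a x x'] /=; last by rewrite /slices_map linearP.
rewrite /slices_map !malg_ext.unlock scaler_sumr -big_split /=.
by apply: eq_bigr => s _; rewrite linearP scalerDr !scalerA mulrC.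
Qed.

HB.instance Definition _ :=
  bilinear_isBilinear.Build k V {malg k[K]} W *:%R *:%R slices_map
    slices_map_bilinear.

Definition slices : {linear tens V {malg k[K]} -> W} := tens_lift slices_map.

Lemma slicesE v s : slices (pure v << s >>) = h s v.
Proof. by rewrite /slices /= tens_liftE /= /slices_map malg_extU. Qed.
End Slices.

Lemma slices_eq (K : choiceType) (V W : lmodType k) (f g : {linear tens V {malg k[K]} -> W}) :
  (forall v s, f (pure v << s >>) = g (pure v << s >>)) -> f =1 g.
Proof.
move=> fg; apply: tens_eq => v x.
rewrite [x]monalgE linear_sumr !linear_sum; apply: eq_bigr => s _ /=.
by rewrite malgUZ linearZr !linearZ /= fg.
Qed.
End Tensor.
Arguments slices {k K V W} h : simpl never.

(** * The structure maps of the smash coproduct *)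

Section Smash.
Variables (k : fieldType) (G : groupType) (C : gcoalgebra G k).
Local Notation D := (smash_coproduct C).

Definition smash_in (a s : G) (c : C a) : D a := pure c << s >>.

Fact smash_in_linear a s : linear (@smash_in a s).
Proof. by move=> d x y; rewrite /smash_in linearPl. Qed.

HB.instance Definition _ a s :=
  GRing.isLinear.Build k (C a) (D a) _ (@smash_in a s) (@smash_in_linear a s).

Definition smash_out (a : G) : {linear D a -> C a} := slices (fun=> idfun).

Lemma smash_inK a s : cancel (@smash_in a s) (@smash_out a).
Proof. by move=> c; rewrite /smash_out /smash_in slicesE. Qed.

(** On the copy C (x) s of C, the comultiplication is that of C, with values in
    the copies indexed by b s and s. *)
Lemma smash_comul_in a b s (c : C (a * b)%g) :
  gc_comul D a b (smash_in s c) = tmap (@smash_in a (b * s)%g) (@smash_in b s) (gc_comul C a b c).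
Proof.
rewrite /= smash_comulE; move: (gc_comul C a b c).
by apply: tens_eq => u v; rewrite tmapE; exact: smash_insertE.
Qed.

Lemma smash_counit_in s (c : C 1%g) :
  gc_counit D (smash_in s c) = gc_counit C c.
Proof. by rewrite /= smash_counitE. Qed.

(** Compatibility of injections N_g -> M with coactions on both sides.  The
    component N_g is placed in degree g^-1: the coaction rho_b leads from
    N_(a b) to N_a, removing b on the right, whereas the smash coproduct
    multiplies by b on the left, and b (a b)^-1 = a^-1. *)
Definition graded_injection (M : lmodType k) (N : G -> lmodType k)
    (rM : forall a, {linear M -> tens M (D a)})
    (rN : forall a b, {linear N (a * b)%g -> tens (N a) (C b)})
    (i : forall g, {linear N g -> M}) : Prop :=
  forall a b (n : N (a * b)%g),
    rM b (i _ n) = tmap (i a) (@smash_in b (a * b)^-1%g) (rN a b n).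

(** Injections compatible with the coactions carry each axiom of a G-C-comodule
    to the corresponding axiom of a comodule, without using either of them.
    Hence the axioms of M follow from those of N when the N_g generate M, and
    those of N follow from those of M when the injections are split. *)
Section GradedInjection.
Variables (M : lmodType k) (N : G -> lmodType k).
Variables (rM : forall a, {linear M -> tens M (D a)})
  (rN : forall a b, {linear N (a * b)%g -> tens (N a) (C b)})
  (i : forall g, {linear N g -> M}).
Hypothesis iP : graded_injection rM rN i.

Lemma injection_ecast g h (e : g = h) (n : N g) : i h (ecast x (N x) e n) = i g n.
Proof. by case: h / e. Qed.

Lemma graded_counit a (n : N (a * 1)%g) :
  tunitr (tmap idfun (gc_counit D) (rM 1%g (i _ n))) =
  i a (tunitr (tmap idfun (gc_counit C) (rN a 1%g n))).
Proof.
rewrite iP -tunitr_natural; apply: (congr1 tunitr).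
by apply: tmap_square => //= c; rewrite smash_counitE.
Qed.

Lemma graded_coassocr a b c (n : N (a * b * c)%g) :
  tassoc (tmap (rM b) idfun (rM c (i _ n))) =
  tmap (i a) (tmap (@smash_in b (a * b)^-1%g) (@smash_in c (a * b * c)^-1%g))
    (tassoc (tmap (rN a b) idfun (rN (a * b)%g c n))).
Proof.
rewrite -tassoc_natural iP; apply: (congr1 tassoc).
by apply: tmap_square => // m; rewrite iP.
Qed.

Lemma graded_coassocl a b c (n : N (a * b * c)%g) :
  tmap idfun (gc_comul D b c) (rM (b * c)%g (i _ n)) =
  tmap (i a) (tmap (@smash_in b (a * b)^-1%g) (@smash_in c (a * b * c)^-1%g))
    (tmap idfun (gc_comul C b c)
      (rN a (b * c)%g (ecast x (N x) (esym (mulgA a b c)) n))).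
Proof.
rewrite -(injection_ecast (esym (mulgA a b c))) iP.
apply: tmap_square => // x; rewrite smash_comul_in mulgA.
by congr (tmap (smash_in _) _ _); rewrite !invgM !mulgA mulgV mul1g.
Qed.
End GradedInjection.
End Smash.

Lemma tmap0r (k : fieldType) (M N M' N' : lmodType k) (f : {linear M -> M'}) x :
  tmap f (\0 : {linear N -> N'}) x = 0.
Proof. by apply: (@tens_eq _ _ _ _ _ \0) => m n; rewrite tmapE linear0r. Qed.

Lemma tmap0l (k : fieldType) (M N M' N' : lmodType k) (f : {linear N -> N'}) x :
  tmap (\0 : {linear M -> M'}) f x = 0.
Proof. by apply: (@tens_eq _ _ _ _ _ \0) => m n; rewrite tmapE linear0l. Qed.

(** How functionals on one factor interact with the associativity isomorphism:
    these are the computations that extract consequences from coassociativity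
    by applying a functional to one tensor factor. *)
Section Contraction.
Variables (k : fieldType) (M X Y Z : lmodType k).

Lemma contract_tassocr (r : {linear M -> tens X Y}) (e : {linear Z -> k^o}) x :
  tmap idfun (tunitr \o tmap idfun e : {linear tens Y Z -> Y}) (tassoc (tmap r idfun x)) =
  r (tunitr (tmap idfun e x)).
Proof.
move: x; apply: (@tens_ind k) => [|d u v hu hv|m z]; first by rewrite !linear0.
  by rewrite !linearP /= hu hv.
rewrite !tmapE tunitrE linearZ /=; move: (r m).
apply: (@tens_ind k) => [|d u v hu hv|x y]; first by rewrite scaler0 linear0l !linear0.
  by rewrite linearPl !linearP /= hu hv !scalerA mulrC.
by rewrite tassocE tmapE /= tmapE tunitrE linearZr.
Qed.

Lemma contract_tassocl (r : {linear M -> tens X Y}) (e : {linear Y -> k^o})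
    (f : {linear M -> X}) x :
  (forall m, f m = tunitr (tmap idfun e (r m))) ->
  tmap idfun (tunitl \o tmap e idfun : {linear tens Y Z -> Z}) (tassoc (tmap r idfun x)) =
  tmap f idfun x.
Proof.
move=> fE; move: x; apply: (@tens_ind k) => [|d u v hu hv|m z]; first by rewrite !linear0.
  by rewrite !linearP /= hu hv.
rewrite !tmapE fE; move: (r m).
apply: (@tens_ind k) => [|d u v hu hv|x y]; first by rewrite linear0l !linear0 linear0l.
  by rewrite linearPl !linearP /= hu hv linearPl.
by rewrite tassocE !tmapE tunitrE /= tmapE tunitlE linearZr linearZl.
Qed.
Lemma contract_tassoc_pure (p : {linear tens Y Z -> k^o}) (e : {linear Y -> k^o})
    (a : k) (z : Z) (t : tens X Y) :
  (forall y, p (pure y z) = a *: e y) ->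
  tunitr (tmap idfun p (tassoc (pure t z))) = a *: tunitr (tmap idfun e t).
Proof.
move=> pE; move: t; apply: (@tens_ind k) => [|d u v hu hv|x y].
- by rewrite linear0l !linear0.
- by rewrite linearPl !linearP /= hu hv.
by rewrite tassocE !tmapE !tunitrE pE scalerA.
Qed.
End Contraction.

(** * The grading of a comodule over the smash coproduct *)

Section Grading.
Variables (k : fieldType) (G : groupType) (C : gcoalgebra G k).
Local Notation D := (smash_coproduct C).

(** The projection of D_b onto C_b (x) s. *)
Definition slice (b s : G) : {linear D b -> D b} :=
  slices (fun t => if t == s then @smash_in k G C b s : {linear C b -> D b} else \0).

Lemma slice_in b s t (c : C b) :
  slice b s (smash_in t c) = if t == s then smash_in t c else 0.
Proof. by rewrite /slice /smash_in slicesE; case: eqP => // ->. Qed.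

Definition slice_counit (s : G) : {linear D 1%g -> k^o} := gc_counit D \o slice 1%g s.

Lemma slice_counit_in s t (c : C 1%g) :
  slice_counit s (smash_in t c) = if t == s then gc_counit C c else 0.
Proof.
rewrite /slice_counit /= slice_in; case: eqP => _; last exact: linear0.
by rewrite smash_counitE.
Qed.

Definition to_kG : {linear D 1%g -> {malg k[G]}} := tunitl \o tmap (gc_counit C) idfun.

Lemma to_kG_in t (c : C 1%g) : to_kG (smash_in t c) = gc_counit C c *: << t >>.
Proof. by rewrite /to_kG /= tmapE tunitlE. Qed.

Lemma smash_eq b (V : lmodType k) (f g : {linear D b -> V}) :
  (forall s c, f (smash_in s c) = g (smash_in s c)) -> f =1 g.
Proof. by move=> fg; apply: slices_eq => c s; exact: fg. Qed.

Lemma slice_id b s : forall d, slice b s (slice b s d) = slice b s d.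
Proof.
apply: (@smash_eq _ _ (slice b s \o slice b s)) => t c /=.
rewrite slice_in; case: eqP => [->|_]; last exact: linear0.
by rewrite slice_in eqxx.
Qed.

Lemma slice_out b s : forall d, smash_in s (smash_out C b (slice b s d)) = slice b s d.
Proof.
pose F : {linear D b -> D b} :=
  @smash_in k G C b s \o (@smash_out k G C b \o slice b s).
apply: (@smash_eq _ _ F) => t c.
change (smash_in s (smash_out C b (slice b s (smash_in t c))) = slice b s (smash_in t c)).
by rewrite slice_in; case: eqP => [->|_]; rewrite ?smash_inK ?linear0.
Qed.

Lemma slice_ecast a b (e : a = b) s (d : D a) :
  slice b s (ecast x (D x) e d) = ecast x (D x) e (slice a s d).
Proof. by case: b / e. Qed.

(** By the formula for the comultiplication, which leaves s in the second factor
    and puts b s in the first one, the slice of an element over s can be cut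
    out on either side after comultiplying; [comul_slicel] is the other side. *)
Lemma comul_slicer a b s : forall d,
  tmap idfun (slice b s) (gc_comul D a b d) = gc_comul D a b (slice (a * b)%g s d).
Proof.
apply: (@smash_eq _ _ (tmap idfun (slice b s) \o gc_comul D a b)
  (gc_comul D a b \o slice (a * b)%g s)) => t c.
rewrite [LHS]/= [RHS]/= -!/(gc_comul D a b) slice_in smash_comul_in; case: eqP => [->|ts].
  rewrite smash_comul_in; apply: tmap_comp => // x.
  by rewrite slice_in eqxx.
rewrite linear0 -[RHS](tmap0r _ (@smash_in k G C a (b * t)%g) (gc_comul C a b c)).
by apply: tmap_comp => // x; rewrite slice_in (negbTE (introN eqP ts)).
Qed.

Lemma comul_slicel a b s : forall d,
  tmap (slice a (b * s)%g) idfun (gc_comul D a b d) = gc_comul D a b (slice (a * b)%g s d).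
Proof.
apply: (@smash_eq _ _ (tmap (slice a (b * s)%g) idfun \o gc_comul D a b)
  (gc_comul D a b \o slice (a * b)%g s)) => t c.
rewrite [LHS]/= [RHS]/= -!/(gc_comul D a b) slice_in smash_comul_in.
case: eqP => [->|ts].
  rewrite smash_comul_in; apply: tmap_comp => // x.
  by rewrite slice_in eqxx.
rewrite linear0 -[RHS](tmap0l _ (@smash_in k G C b t) (gc_comul C a b c)).
apply: tmap_comp => // x; rewrite slice_in (inj_eq (@mulgI _ b)).
by rewrite (negbTE (introN eqP ts)).
Qed.

Lemma tens_smash_eq (M V : lmodType k) b (f g : {linear tens M (D b) -> V}) :
  (forall m s c, f (pure m (smash_in s c)) = g (pure m (smash_in s c))) -> f =1 g.
Proof.
move=> fg; apply: tens_eq => m d; move: d; apply: (@smash_ind G k C b).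
- by rewrite linear0r !linear0.
- by move=> e x y fx fy; rewrite linearPr !linearP /= fx fy.
- by move=> c s; exact: fg.
Qed.

Section Comodule.
Variable M : comodule D.
Local Notation rho := (cm_coact M).

(** P_s = (M (x) slice_counit s) o rho_1, the projection onto the component
    N_(s^-1). *)
Definition grade (s : G) : {linear M -> M} :=
  tunitr \o (tmap idfun (slice_counit s) \o rho 1%g).

Lemma coact_ecast a b (e : a = b) (V : lmodType k) (f : {linear D b -> V})
    (f' : {linear D a -> V}) m :
  (forall d, f' d = f (ecast x (D x) e d)) ->
  tmap idfun f' (rho a m) = tmap idfun f (rho b m).
Proof. by case: b / e f => f ff'; apply: tmap_eq. Qed.

(** Coassociativity of rho_(b 1), with the counit applied on the slice over s of
    the last factor. *)
Lemma coact_grade b s m : rho b (grade s m) = tmap idfun (slice b s) (rho b m).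
Proof.
rewrite /grade /= -contract_tassocr -cm_coassoc.
set f := (_ \o _ : {linear _ -> _}).
rewrite (@tmap_comp _ _ _ _ _ _ _ idfun idfun idfun _ _ (f \o gc_comul D b 1%g)) //.
apply: (coact_ecast (e := mulg1 b)) => d.
rewrite slice_ecast -gc_counitr -comul_slicer /f /=; apply: (congr1 tunitr).
by rewrite -!/(gc_comul D b 1%g); symmetry; apply: tmap_comp.
Qed.

(** Coassociativity of rho_(1 b), with the counit applied on the slice over b s of
    the middle factor; together with [coact_grade] this says that rho_b maps the
    image of P_s to the image of P_(b s). *)
Lemma grade_coact b s m :
  tmap (grade (b * s)%g) idfun (rho b m) = tmap idfun (slice b s) (rho b m).
Proof.
rewrite -(contract_tassocl (r := rho 1%g) (e := slice_counit (b * s)%g)) // -cm_coassoc.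
set f := (_ \o _ : {linear _ -> _}).
rewrite (@tmap_comp _ _ _ _ _ _ _ idfun idfun idfun _ _ (f \o gc_comul D 1%g b)) //.
apply: (coact_ecast (e := mul1g b)) => d.
rewrite slice_ecast -gc_counitl -comul_slicel /f /=; apply: (congr1 tunitl).
by rewrite -!/(gc_comul D 1%g b); symmetry; apply: tmap_comp.
Qed.

Lemma grade_id s m : grade s (grade s m) = grade s m.
Proof.
rewrite {1}/grade /= coact_grade /grade /=; apply: (congr1 tunitr).
by apply: tmap_comp => // d; rewrite /= slice_id.
Qed.

(** The map m |-> sum_s h_s(P_s m).  The sum is finite, as it runs over the
    group elements occurring in rho_1(m); it is written as a linear map on
    M (x) kG. *)
Definition assemble (V : lmodType k) (h : G -> {linear M -> V}) : {linear M -> V} :=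
  slices h \o (tmap idfun to_kG \o rho 1%g).

Lemma assemble_grade (V : lmodType k) (h : G -> {linear M -> V}) s m :
  assemble h (grade s m) = h s (grade s m).
Proof.
rewrite /assemble /= coact_grade /grade /= -tunitr_natural; move: (rho 1%g m).
pose F : {linear tens M (D 1%g) -> V} :=
  slices h \o (tmap idfun to_kG \o tmap idfun (slice 1%g s)).
pose F' : {linear tens M (D 1%g) -> V} :=
  tunitr \o (tmap (h s) idfun \o tmap idfun (slice_counit s)).
apply: (@tens_smash_eq _ _ _ F F') => u t c.
rewrite {}/F {}/F' /= !tmapE tunitrE slice_in slice_counit_in.
case: eqP => [<-|_]; first by rewrite to_kG_in linearZr linearZ /= slicesE.
by rewrite linear0 linear0r linear0 scale0r.
Qed.

Lemma assemble_comp (V W : lmodType k) (f : {linear V -> W}) (h : G -> {linear M -> V})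
    (h' : G -> {linear M -> W}) m :
  (forall s m, f (h s m) = h' s m) -> f (assemble h m) = assemble h' m.
Proof.
move=> fh; rewrite /assemble /=.
by apply: (@slices_eq _ _ _ _ (f \o slices h) (slices h')) => u s /=; rewrite !slicesE.
Qed.

(** The functional (c (x) s) (x) (d (x) t) |-> [s = t] eps(c) eps(d), which
    undoes the comultiplication D_1 -> D_1 (x) D_1 up to the counit. *)
Definition pairing : {linear tens (D 1%g) (D 1%g) -> k^o} :=
  slices slice_counit \o tmap idfun to_kG.

Lemma pairing_comul (d : D (1 * 1)%g) :
  pairing (gc_comul D 1%g 1%g d) = gc_counit D (ecast x (D x) (mulg1 1%g) d).
Proof.
rewrite -gc_counitr; move: d.
pose F : {linear D (1 * 1)%g -> k^o} := pairing \o gc_comul D 1%g 1%g.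
pose F' : {linear D (1 * 1)%g -> k^o} :=
  gc_counit D \o (tunitr \o (tmap idfun (gc_counit D) \o gc_comul D 1%g 1%g)).
apply: (@smash_eq _ _ F F') => t c; rewrite {}/F {}/F' /= -!/(gc_comul D 1%g 1%g).
rewrite smash_comul_in -tunitr_natural mul1g.
move: (gc_comul C 1%g 1%g c).
pose F : {linear tens (C 1%g) (C 1%g) -> k^o} := pairing \o tmap (smash_in t) (smash_in t).
pose F' : {linear tens (C 1%g) (C 1%g) -> k^o} :=
  tunitr \o (tmap (gc_counit D) idfun \o (tmap idfun (gc_counit D) \o tmap (smash_in t) (smash_in t))).
apply: (@tens_eq _ _ _ _ F F') => x y; rewrite {}/F {}/F' /= !tmapE tunitrE.
rewrite to_kG_in linearZr linearZ /= slicesE slice_counit_in eqxx.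
by rewrite -!/(gc_counit D) !smash_counit_in.
Qed.

(** The idempotents P_s = P_s P_s sum to the identity.  Pairing the two copies of D_1 in
    coassociativity of rho_(1 1) gives (M (x) eps) rho_1(m) = m on one side, and
    the sum of the P_s P_s m on the other. *)
Lemma assemble_id m : assemble grade m = m.
Proof.
rewrite -[RHS]cm_counit.
rewrite -(@coact_ecast _ _ (mulg1 1%g) _ (gc_counit D) (pairing \o gc_comul D 1%g 1%g));
  last exact: pairing_comul.
rewrite -(@tmap_comp _ _ _ _ _ _ _ idfun idfun idfun (gc_comul D 1%g 1%g) pairing) //.
rewrite cm_coassoc /assemble /=; move: (rho 1%g m).
pose F : {linear tens M (D 1%g) -> M} := slices grade \o tmap idfun to_kG.
pose F' : {linear tens M (D 1%g) -> M} :=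
  tunitr \o (tmap idfun pairing \o (tassoc \o tmap (rho 1%g) idfun)).
apply: (@tens_smash_eq _ _ _ F F') => u t c; rewrite {}/F {}/F' /=.
rewrite !tmapE to_kG_in linearZr linearZ /= slicesE.
symmetry; apply: contract_tassoc_pure => d.
by rewrite /pairing /= tmapE to_kG_in linearZr linearZ /= slicesE.
Qed.

Lemma grade_generates (V : lmodType k) (f f' : {linear M -> V}) :
  (forall s m, f (grade s m) = f' (grade s m)) -> f =1 f'.
Proof.
move=> ff' m; rewrite -(assemble_id m).
pose h s : {linear M -> V} := f' \o grade s.
by rewrite !(@assemble_comp _ _ _ _ h).
Qed.
End Comodule.

(** P_s is built from the coaction, so morphisms preserve the grading. *)
Lemma grade_natural (M M' : comodule D) (f : comodule_hom M M') s m :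
  f (grade M s m) = grade M' s (f m).
Proof.
rewrite /grade /= -cm_mapP -tunitr_natural; apply: (congr1 tunitr).
exact: tmap_square.
Qed.

(** The injections put N_g in degree g^-1. *)
Lemma grade_injection (M : comodule D) (N : gcomodule C) i :
  graded_injection (cm_coact M) (gm_coact N) i ->
  forall s g (n : N g), grade M s (i g n) = if g^-1%g == s then i g n else 0.
Proof.
move=> iP s g n; rewrite -(injection_ecast i (esym (mulg1 g)) n).
move: (ecast _ _ _ _) => {}n; rewrite /grade /= iP.
rewrite (@tmap_comp _ _ _ _ _ _ _ (i g) idfun (i g) _ _
  (if (g^-1 == s)%g then gc_counit C else \0)) //; last first.
  by move=> c; rewrite slice_counit_in mulg1; case: eqP.
case: eqP => _; last by rewrite tmap0r linear0.
rewrite -(injection_ecast i (mulg1 g)) -gm_counit -tunitr_natural.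
by apply: (congr1 tunitr); symmetry; apply: tmap_comp.
Qed.
End Grading.

(** * Decompositions and their morphisms *)

Section Links.
Variables (k : fieldType) (G : groupType) (C : gcoalgebra G k).
Local Notation D := (smash_coproduct C).

(** The universal property of the direct sum, with uniqueness stated apart since
    it is the part used to compare linear maps. *)
Definition is_coproduct (I : Type) (N : I -> lmodType k) (M : lmodType k)
    (i : forall g, {linear N g -> M}) : Prop :=
  (forall (V : lmodType k) (h : forall g, {linear N g -> V}),
     exists f : {linear M -> V}, forall g n, f (i g n) = h g n) /\
  (forall (V : lmodType k) (f f' : {linear M -> V}),
     (forall g n, f (i g n) = f' (i g n)) -> f =1 f').

Definition decomposes (N : gcomodule C) (M : comodule D)
    (i : forall g, {linear N g -> M}) : Prop :=
  is_coproduct (N := fun g => N g) i /\ graded_injection (cm_coact M) (gm_coact N) i.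

(** The family N_x -> N_g of Kronecker deltas.  The identity of N_g has to be
    transported along x = g, hence the existential form. *)
Lemma kronecker (I : Type) (N : I -> lmodType k) (g : I) :
  exists d : forall x, {linear N x -> N g},
    (forall n, d g n = n) /\ (forall x n, x <> g -> d x n = 0).
Proof.
have /(_ _)/cid-/all_sig[d dP] x : exists d : {linear N x -> N g},
    (forall e : x = g, forall n, d n = ecast x (N x) e n) /\
    (x <> g -> forall n, d n = 0).
  have [e|ne] := pselect (x = g); last by exists \0.
  case: g / e; exists idfun; split=> [e n|//].
  by rewrite (Prop_irrelevance e erefl).
exists d; split=> [n|x n xg]; last exact: (proj2 (dP x)).
by rewrite (proj1 (dP g) erefl).
Qed.

Lemma coproduct_proj (N : G -> lmodType k) (M : lmodType k)
    (i : forall g, {linear N g -> M}) :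
  is_coproduct i -> forall g, exists p : {linear M -> N g},
    cancel (i g) p /\ forall h n, h <> g -> p (i h n) = 0.
Proof.
move=> [univ _] g.
have [h [h1 h0]] := kronecker N g.
have [p pP] := univ _ h; exists p; split=> [n|x n xg]; rewrite pP.
  exact: h1.
exact: h0.
Qed.

(** Morphisms N -> N' and morphisms M -> M' determine each other through the
    injections. *)
Section HomTransfer.
Variables (N N' : gcomodule C) (M M' : comodule D).
Variables (i : forall g, {linear N g -> M}) (i' : forall g, {linear N' g -> M'}).
Hypotheses (iP : decomposes i) (i'P : decomposes i').

Lemma comodule_hom_of (phi : gcomodule_hom N N') :
  exists f : comodule_hom M M', forall g n, f (i g n) = i' g (phi g n).
Proof.
have [[univ gen] iC] := iP; have [_ iC'] := i'P.
have [f fP] := univ _ (fun g => i' g \o phi g : {linear N g -> M'}).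
have fC b m : tmap f idfun (cm_coact M b m) = cm_coact M' b (f m).
  move: m; pose F : {linear M -> tens M' (D b)} := tmap f idfun \o cm_coact M b.
  pose F' : {linear M -> tens M' (D b)} := cm_coact M' b \o f.
  apply: (gen _ F F') => g n; rewrite {}/F {}/F' /=.
  rewrite -(injection_ecast i (esym (mulgVK b g)) n).
  move: (ecast _ _ _ _) => {}n; rewrite fP iC iC' -gm_mapP.
  by apply: tmap_square => // x; rewrite fP.
by exists (ComoduleHom fC).
Qed.

Lemma comodule_hom_inj (f f' : comodule_hom M M') :
  (forall g n, f (i g n) = f' (i g n)) -> f = f'.
Proof. by move=> ff'; apply: comodule_hom_eq; exact: (proj2 (proj1 iP)). Qed.

Lemma gcomodule_hom_inj (phi phi' : gcomodule_hom N N') :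
  (forall g n, i' g (phi g n) = i' g (phi' g n)) -> phi = phi'.
Proof.
move=> e; apply: gcomodule_hom_eq => g n.
by have [p [pK _]] := coproduct_proj (proj1 i'P) g; apply: (can_inj pK); exact: e.
Qed.

(** A colinear [f] commutes with the projections P_s, so it maps N_g into the
    image of N'_g. *)
Lemma gcomodule_hom_of (f : comodule_hom M M') :
  exists phi : gcomodule_hom N N', forall g n, f (i g n) = i' g (phi g n).
Proof.
have [_ iC] := iP; have [[_ gen'] iC'] := i'P.
have /(_ _)/cid-/all_sig[p pP] g := coproduct_proj (proj1 i'P) g.
have gradeE g m : grade M' g^-1%g m = i' g (p g m).
  move: m; apply: (gen' _ (grade M' g^-1%g) (i' g \o p g)) => h n.
  rewrite [RHS]/= (grade_injection iC') (inj_eq (@invg_inj G)).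
  case: eqP => [e|/(proj2 (pP g)) ->]; last by rewrite linear0.
  by case: g / e; rewrite (proj1 (pP h)).
have fi g n : f (i g n) = i' g (p g (f (i g n))).
  by rewrite -gradeE -grade_natural (grade_injection iC) eqxx.
pose phi g : {linear N g -> N' g} := p g \o (f \o i g).
have phiP a b n : tmap (phi a) idfun (gm_coact N a b n) = gm_coact N' a b (phi (a * b)%g n).
  apply: (tmap_inj (f := i' a) (g := @smash_in k G C b (a * b)^-1%g) (proj1 (pP a)) (@smash_inK k G C b _)).
  rewrite -iC' /phi /= -fi -cm_mapP iC.
  by apply: tmap_square => //= x; rewrite -fi.
by exists (GComoduleHom phiP) => g n; exact: fi.
Qed.
End HomTransfer.
End Links.

(** * Splitting idempotents and direct sums *)

Section Image.
Variables (k : fieldType) (V : lmodType k) (P : {linear V -> V}).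

Definition fixed : {pred V} := fun v => P v == v.

Fact fixed_submod : submod_closed fixed.
Proof.
split=> [|a u v]; rewrite !unfold_in; first by rewrite linear0.
by move=> /eqP eu /eqP ev; rewrite linearP eu ev.
Qed.

HB.instance Definition _ := GRing.isSubmodClosed.Build k V fixed fixed_submod.

Record fixed_space := FixedSpace { fixed_val :> V; _ : fixed_val \in fixed }.

HB.instance Definition _ := [isSub for fixed_val].
HB.instance Definition _ := [Choice of fixed_space by <:].
HB.instance Definition _ := [SubChoice_isSubLmodule of fixed_space by <:].

(** The image of an idempotent is the space of its fixed vectors. *)
Lemma idempotent_split : (forall v, P (P v) = P v) ->
  exists (W : lmodType k) (j : {linear W -> V}) (q : {linear V -> W}),
    (forall w, q (j w) = w) /\ (forall v, j (q v) = P v).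
Proof.
move=> PP.
have fixP v : P v \in fixed by rewrite unfold_in PP.
pose q v := FixedSpace (fixP v).
have q_linear : linear q by move=> a u v; apply: val_inj; rewrite /= linearP.
pose j : {linear fixed_space -> V} := val.
pose qL : {linear V -> fixed_space} := HB.pack q (GRing.isLinear.Build k _ _ _ q q_linear).
exists fixed_space, j, qL; split=> // -[w wP]; apply: val_inj => /=.
by move: wP; rewrite unfold_in => /eqP.
Qed.
End Image.

Section Product.
Variables (k : fieldType) (I : Type) (N : I -> lmodType k).

(** The full product, named so that it carries its own vector space structure. *)
Definition product : Type := forall x, N x.

HB.instance Definition _ := gen_eqMixin product.
HB.instance Definition _ := gen_choiceMixin product.

Let add (f g : product) : product := fun x => f x + g x.
Let opp (f : product) : product := fun x => - f x.
Let scale (a : k) (f : product) : product := fun x => a *: f x.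

Let ext (f g : product) : (forall x, f x = g x) -> f = g.
Proof. exact: functional_extensionality_dep. Qed.

Fact product_addA : associative add.
Proof. by move=> f g h; apply: ext => x; rewrite /add addrA. Qed.
Fact product_addC : commutative add.
Proof. by move=> f g; apply: ext => x; rewrite /add addrC. Qed.
Fact product_add0 : left_id (fun x => 0) add.
Proof. by move=> f; apply: ext => x; rewrite /add add0r. Qed.
Fact product_addN : left_inverse (fun x => 0) opp add.
Proof. by move=> f; apply: ext => x; rewrite /add /opp addNr. Qed.

HB.instance Definition _ := GRing.isZmodule.Build product
  product_addA product_addC product_add0 product_addN.

Fact product_scaleA a b f : scale a (scale b f) = scale (a * b) f.
Proof. by apply: ext => x; rewrite /scale scalerA. Qed.
Fact product_scale1 : left_id 1 scale.
Proof. by move=> f; apply: ext => x; rewrite /scale scale1r. Qed.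
Fact product_scaleDr : right_distributive scale +%R.
Proof. by move=> a f g; apply: ext => x; rewrite /scale scalerDr. Qed.
Fact product_scaleDl f : {morph scale^~ f : a b / a + b}.
Proof. by move=> a b; apply: ext => x; rewrite /scale scalerDl. Qed.

HB.instance Definition _ := GRing.Zmodule_isLmodule.Build k product
  product_scaleA product_scale1 product_scaleDr product_scaleDl.

(** All the spaces N_g are retracts of their product. *)
Lemma common_retract : exists (W : lmodType k)
    (i : forall g, {linear N g -> W}) (p : forall g, {linear W -> N g}),
  forall g n, p g (i g n) = n.
Proof.
have /(_ _)/cid-/all_sig[d dP] g := kronecker N g.
pose i g (n : N g) : product := fun x => d x g n.
have i_linear g : linear (@i g) by move=> a u v; apply: ext => x; rewrite /i linearP.
pose p g (f : product) : N g := f g.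
have p_linear g : linear (p g) by [].
pose iL g : {linear N g -> product} :=
  HB.pack (@i g) (GRing.isLinear.Build k _ _ _ (@i g) (i_linear g)).
pose pL g : {linear product -> N g} :=
  HB.pack (p g) (GRing.isLinear.Build k _ _ _ (p g) (p_linear g)).
exists product, iL, pL => g n; exact: (proj1 (dP g)).
Qed.
End Product.

(** If the N_g are retracts of W, by i_g and p_g, their direct sum is the image
    of the idempotent w (x) g |-> i_g p_g w (x) g of W (x) kG. *)
Lemma direct_sum_exists (k : fieldType) (G : choiceType) (N : G -> lmodType k) :
  exists (M : lmodType k) (i : forall g, {linear N g -> M}), is_coproduct i.
Proof.
have [W [i [p pK]]] := common_retract N.
have place_linear g : linear (fun w => pure (i g (p g w)) << g >> : tens W {malg k[G]}).
  by move=> a u v; rewrite !linearP linearPl.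
pose place g : {linear W -> tens W {malg k[G]}} :=
  HB.pack (fun w => pure (i g (p g w)) << g >>) (GRing.isLinear.Build k _ _ _ _ (place_linear g)).
have placeE g w : place g w = pure (i g (p g w)) << g >> by [].
pose E := slices place.
have EE x : E (E x) = E x.
  move: x; apply: (slices_eq (f := E \o E)) => w g.
  by change (E (E (pure w << g >>)) = E (pure w << g >>)); rewrite /E slicesE placeE slicesE placeE pK.
have [M [j [q [qK jq]]]] := idempotent_split EE.
have inc_linear g : linear (fun n => pure (i g n) << g >> : tens W {malg k[G]}).
  by move=> a u v; rewrite linearP linearPl.
pose inc g : {linear N g -> tens W {malg k[G]}} :=
  HB.pack (fun n => pure (i g n) << g >>) (GRing.isLinear.Build k _ _ _ _ (inc_linear g)).
exists M, (fun g => q \o inc g); split=> [V h|V f f' ff' m].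
  pose h' g : {linear W -> V} := h g \o p g.
  exists (slices h' \o j) => g n /=.
  by rewrite jq /E slicesE placeE slicesE /= !pK.
rewrite -(qK m); move: (j m).
apply: (slices_eq (f := f \o q) (g := f' \o q)) => w g /=.
suff -> : q (pure w << g >>) = q (inc g (p g w)) by exact: ff'.
by rewrite -(qK (q _)) jq /E slicesE.
Qed.

(** * Existence of decompositions *)

Lemma vspace_exists (k : fieldType) (V : lmodType k) :
  exists W : vspace k, vspace_lmod W = V.
Proof. by have [f f_inj] := coded_small V; exists (Vspace f_inj). Qed.

Section Existence.
Variables (k : fieldType) (G : groupType) (C : gcoalgebra G k).
Local Notation D := (smash_coproduct C).

(** The direct sum of the components, with rho_b given on N_(a b) by the
    coaction of N with (a b)^-1 inserted. *)
Lemma comodule_of_gcomodule (N : gcomodule C) :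
  exists (M : comodule D) (i : forall g, {linear N g -> M}), decomposes i.
Proof.
have [V [i [univ gen]]] := direct_sum_exists (fun g => N g : lmodType k).
have [M MV] := vspace_exists V.
move: i univ gen; rewrite -{V}MV => i univ gen.
have /(_ _)/cid-/all_sig[rho rhoP] b : exists r : {linear M -> tens M (D b)},
    forall a (n : N (a * b)%g),
    r (i _ n) = tmap (i a) (@smash_in k G C b (a * b)^-1%g) (gm_coact N a b n).
  have /(_ _)/cid-/all_sig[h hP] g : exists h : {linear N g -> tens M (D b)},
      forall a (e : (a * b)%g = g) n, h (ecast x (N x) e n) =
        tmap (i a) (@smash_in k G C b (a * b)^-1%g) (gm_coact N a b n).
    (* Every g is a b for a = g b^-1; moving to this form avoids transports. *)
    rewrite -(mulgVK b g); set a := (g * b^-1)%g.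
    exists (tmap (i a) (@smash_in k G C b (a * b)^-1%g) \o gm_coact N a b) => a' e.
    have ea : a' = a by apply: (mulIg b).
    move: e; rewrite ea => e n.
    by rewrite (Prop_irrelevance e erefl).
  have [r rP] := univ _ h; exists r => a n; rewrite rP.
  exact: (hP _ a erefl).
have iC : graded_injection rho (gm_coact N) i by move=> a b n; exact: rhoP.
have counit m : tunitr (tmap idfun (gc_counit D) (rho 1%g m)) = m.
  move: m; apply: (gen _ (tunitr \o (tmap idfun (gc_counit D) \o rho 1%g)) idfun) => g n.
  rewrite -(injection_ecast i (esym (mulg1 g)) n); move: (ecast _ _ _ _) => {}n.
  rewrite [LHS](graded_counit iC) gm_counit.
  exact: (injection_ecast i).
have coassoc a b m : tmap idfun (gc_comul D a b) (rho (a * b)%g m) =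
    tassoc (tmap (rho a) idfun (rho b m)).
  move: m; apply: (gen _ (tmap idfun (gc_comul D a b) \o rho (a * b)%g)
    (tassoc \o (tmap (rho a) idfun \o rho b))) => g n.
  rewrite -(injection_ecast i (esym (mulgVK b g)) n); move: (ecast _ _ _ _).
  move: (g * b^-1)%g => h {}n.
  rewrite -(injection_ecast i (esym (congr1 (fun x => x * b)%g (mulgVK a h))) n).
  move: (ecast _ _ _ _) => {}n.
  by rewrite [LHS](graded_coassocl iC) [RHS](graded_coassocr iC) gm_coassoc.
by exists (Comodule counit coassoc), i.
Qed.

(** The components are the images of the projections P_s. *)
Lemma gcomodule_of_comodule (M : comodule D) :
  exists (N : gcomodule C) (i : forall g, {linear N g -> M}), decomposes i.
Proof.
have /(_ _)/cid-/all_sig[N NP] g : exists N : vspace k,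
    exists (i : {linear N -> M}) (p : {linear M -> N}),
    cancel i p /\ (forall m, i (p m) = grade M g^-1%g m).
  have [V [i [p [iK ip]]]] := idempotent_split (@grade_id _ _ _ M g^-1%g).
  have [N NV] := vspace_exists V; move: i p iK ip; rewrite -NV => i p iK ip.
  by exists N, i, p.
have /(_ _)/cid-/all_sig[i iP] g := NP g.
have {iP} /(_ _)/cid-/all_sig[p ipP] g := iP g.
have iK g := proj1 (ipP g); have ip g := proj2 (ipP g) => {ipP NP}.
pose rho a b : {linear N (a * b)%g -> tens (N a) (C b)} :=
  tmap (p a) (@smash_out k G C b) \o (cm_coact M b \o i (a * b)%g).
have gradei g n : grade M g^-1%g (i g n) = i g n by rewrite -ip iK.
have iC : graded_injection (cm_coact M) rho i.
  move=> a b n; rewrite /rho /=.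
  have e : (b * (a * b)^-1 = a^-1)%g by rewrite invgM mulVKg.
  move: (grade_coact b (a * b)^-1%g (i _ n)) (coact_grade b (a * b)^-1%g (i _ n)).
  rewrite gradei e; move: (cm_coact M b _) => y gy sy; rewrite -sy in gy.
  rewrite -[LHS]gy [in RHS]sy.
  rewrite (@tmap_comp _ _ _ _ _ _ _ idfun (p a) (p a) _ _
    (@smash_out k G C b \o slice C b (a * b)^-1%g)) //.
  rewrite (@tmap_comp _ _ _ _ _ _ _ (p a) (i a) (grade M a^-1%g) _ _
    (slice C b (a * b)^-1%g)) //.
    rewrite {1}sy; exact: tmap_comp.
  by move=> d; exact: slice_out.
have gen (V : lmodType k) (f f' : {linear M -> V}) :
    (forall g n, f (i g n) = f' (i g n)) -> f =1 f'.
  move=> ff'; apply: grade_generates => s m.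
  by rewrite -(invgK s) -ip; exact: ff'.
have univ (V : lmodType k) (h : forall g, {linear N g -> V}) :
    exists f : {linear M -> V}, forall g n, f (i g n) = h g n.
  pose h' s : {linear M -> V} := h s^-1%g \o p s^-1%g.
  exists (assemble h') => g n.
  by rewrite -gradei assemble_grade gradei /h' /= invgK iK.
have counit a (n : N (a * 1)%g) : tunitr (tmap idfun (gc_counit C) (rho a 1%g n)) =
    ecast x (N x) (mulg1 a) n.
  apply: (can_inj (iK a)); rewrite -(graded_counit iC) cm_counit.
  by rewrite (injection_ecast i).
have coassoc a b c (n : N (a * b * c)%g) :
    tassoc (tmap (rho a b) idfun (rho (a * b)%g c n)) =
    tmap idfun (gc_comul C b c)
      (rho a (b * c)%g (ecast x (N x) (esym (mulgA a b c)) n)).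
  apply: (tmap_inj (f := i a)
    (g := tmap (@smash_in k G C b (a * b)^-1%g) (@smash_in k G C c (a * b * c)^-1%g))
    (iK a) (g' := tmap (@smash_out k G C b) (@smash_out k G C c))).
    move=> x; rewrite -[RHS]tmap_id; apply: tmap_comp => u; exact: smash_inK.
  by rewrite -(graded_coassocr iC) -(graded_coassocl iC) cm_coassoc.
by exists (GComodule counit coassoc), i.
Qed.
End Existence.

(** * Many isomorphic copies *)

(** The names of the vectors do not enter the structure maps: pairing each name
    with a set [u] gives as many copies of a space as there are sets. *)
Section Rename.
Variables (k : fieldType) (V : vspace k) (u : uset).

Fact rename_inj : injective (fun v : V => uset_pair u (elem v)).
Proof. by move=> v w /uset_pair_inj [_ /elem_inj]. Qed.

Definition rename : vspace k := Vspace rename_inj.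
End Rename.

Lemma rename_uset_inj (k : fieldType) (V : vspace k) : injective (@rename k V).
Proof.
move=> u u' /(congr1 (fun W : vspace k => elem (0 : W))).
by case/uset_pair_inj.
Qed.

Section Objects.
Variables (k : fieldType) (G : groupType) (C : gcoalgebra G k).
Local Notation D := (smash_coproduct C).

Definition rename_comodule (M : comodule D) (u : uset) : comodule D :=
  @Comodule G k D (rename M u) (@cm_coact G k D M) (@cm_counit G k D M) (@cm_coassoc G k D M).

Definition rename_gcomodule (N : gcomodule C) (u : uset) : gcomodule C :=
  @GComodule G k C (fun g => rename (N g) u) (@gm_coact G k C N) (@gm_counit G k C N)
    (@gm_coassoc G k C N).

Definition is_decomposition (N : gcomodule C) (M : comodule D) : Prop :=
  exists i : forall g, {linear N g -> M}, decomposes i.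

Lemma comodule_many N M :
  is_decomposition N M -> contains_many uset (is_decomposition N).
Proof.
move=> [i iP]; exists (rename_comodule M); last by move=> u; exists i.
by move=> u u' /(congr1 (@cm_space G k D)) /rename_uset_inj.
Qed.

Lemma gcomodule_many N M :
  is_decomposition N M -> contains_many uset (is_decomposition^~ M).
Proof.
move=> [i iP]; exists (rename_gcomodule N); last by move=> u; exists i.
by move=> u u' /(congr1 (fun N' : gcomodule C => gm_space N' 1%g)) /rename_uset_inj.
Qed.

(** Two comodules decomposed by the same N' are isomorphic, and a decomposition
    can be carried along an isomorphism. *)
Lemma is_decomposition_difunctional N N' M M' :
  is_decomposition N M -> is_decomposition N' M -> is_decomposition N' M' ->
  is_decomposition N M'.
Proof.
move=> [i [[univ gen] iC]] [j jP] [j' j'P].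
have [f fj] := comodule_hom_of jP j'P (gcomodule_id N').
have [h hj] := comodule_hom_of j'P jP (gcomodule_id N').
have fK m : h (f m) = m.
  move: m; apply: (proj2 (proj1 jP) _ (h \o f) idfun) => g n /=.
  by rewrite fj /= hj.
have hK m : f (h m) = m.
  move: m; apply: (proj2 (proj1 j'P) _ (f \o h) idfun) => g n /=.
  by rewrite hj /= fj.
exists (fun g => f \o i g); split; first split.
- move=> V t; have [s sP] := univ V t.
  by exists (s \o h) => g n /=; rewrite fK.
- move=> V s s' ss' m; rewrite -(hK m); move: (h m).
  exact: (gen _ (s \o f) (s' \o f)).
- move=> a b n /=; rewrite -cm_mapP iC.
  exact: tmap_comp.
Qed.
End Objects.

(** * The isomorphism of categories *)

Lemma cat_isomorphic_sym (C D : category) : cat_isomorphic C D -> cat_isomorphic D C.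
Proof. by case=> F [F' [e e']]; exists F', F. Qed.

Theorem proposition2p2 (k : fieldType) (G : groupType) (C : gcoalgebra G k) :
  cat_isomorphic (comodule_cat (smash_coproduct C)) (gcomodule_cat C).
Proof.
apply: cat_isomorphic_sym.
have [F [F' [FK F'K /(_ _)/cid FP]]] := matching_bijection
  (@coded_gcomodule G k C) (@coded_comodule G k (smash_coproduct C))
  (@comodule_of_gcomodule k G C) (@gcomodule_of_comodule k G C)
  (@is_decomposition_difunctional k G C) (@gcomodule_many k G C) (@comodule_many k G C).
have {FP} /all_sig[i iP] := FP.
have /(_ _ _ _)/cid hom_of N N' (phi : gcomodule_hom N N') :=
  comodule_hom_of (iP N) (iP N') phi.
pose Fmap N N' phi := sval (hom_of N N' phi).
have FmapP N N' phi g n : Fmap N N' phi (i N g n) = i N' g (phi g n) :=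
  svalP (hom_of N N' phi) g n.
have Fmap_id N : Fmap N N (gcomodule_id N) = comodule_id (F N).
  by apply: (comodule_hom_inj (iP N)) => g n; rewrite FmapP.
have Fmap_comp N N' N'' (psi : gcomodule_hom N' N'') (phi : gcomodule_hom N N') :
    Fmap _ _ (gcomodule_comp psi phi) = comodule_comp (Fmap _ _ psi) (Fmap _ _ phi).
  by apply: (comodule_hom_inj (iP N)) => g n; rewrite /= !FmapP.
pose FF : functor (gcomodule_cat C) (comodule_cat (smash_coproduct C)) :=
  @Functor (gcomodule_cat C) (comodule_cat (smash_coproduct C)) F Fmap Fmap_id Fmap_comp.
apply: (@fully_faithful_bijective_isomorphic _ _ FF F' FK F'K) => N N'.
have /(_ _)/cid-/all_sig[back backP] (f : comodule_hom (F N) (F N')) :=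
  gcomodule_hom_of (iP N) (iP N') f.
exists back => [phi|f] /=.
  by apply: (gcomodule_hom_inj (iP N')) => g n; rewrite -backP FmapP.
by apply: (comodule_hom_inj (iP N)) => g n; rewrite FmapP backP.
Qed.
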